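(* Let $m\geq3$ be odd. For $i\in\{1,2\}$, let $(T_i,\psi_i)$ be a good $C_m$-gluing template, let $J_i=J(T_i,\psi_i)$, and let $H_i$ be obtained from $J_i$ by deleting $\ell_i\geq0$ connected components with exactly two vertices and an arbitrary number of connected components with exactly one vertex. Suppose $e(H_i)\geq m$ for $i\in\{1,2\}$, and let $p_1,p_2\in(0,1)$ with $p_1+p_2=1$ satisfy \[\frac{e(H_1)+\ell_1}{e(H_1)p_1^{m-1}}=\frac{e(H_2)+\ell_2}{e(H_2)p_2^{m-1}}.\] Then $(H_1,H_2)$ is $(p_1,p_2)$-common.
   Context: Graphs are finite and simple; $e(\cdot)$ counts edges; $C_m$ is the $m$-cycle. An $F$-gluing template is a pair $(T,\psi)$ where $T$ is a finite tree and $\psi:V(T)\cup E(T)\to 2^{V(F)}$ satisfies $\psi(st)\subseteq\psi(s)\cap\psi(t)$ for every edge $st$ of $T$. The graph $J(T,\psi)$ is obtained by taking, for each $s\in V(T)$, a copy $F_s$ of the induced subgraph $F[\psi(s)]$, and then, for each edge $st\in E(T)$ and each $v\in\psi(st)$, identifying the vertex of $F_s$ corresponding to $v$ with that of $F_t$ corresponding to $v$. For $S_1,S_2\subseteq V(F)$ write $S_1\sim_F S_2$ if some automorphism $\varphi$ of $F$ has $\varphi(S_1)=S_2$. Consider the real vector space with a basis vector for each $\sim_F$-class of nonempty subsets of $V(F)$; for $S\subseteq V(F)$ let $\vec e_S$ be the basis vector of the class of $S$ if $S\neq\emptyset$, and $\vec e_\emptyset=\vec 0$. Define $\vec z_{T,\psi}:=\sum_{s\in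 V(T)}\vec e_{\psi(s)}-\sum_{st\in E(T)}\vec e_{\psi(st)}$ and, for pairwise disjoint $R_1,R_2,R_3\subseteq V(F)$, $\vec x_{R_1,R_2,R_3}:=\vec e_{R_1\cup R_2\cup R_3}-\vec e_{R_2\cup R_3}-\vec e_{R_1\cup R_2}+\vec e_{R_2}$. The template is good if $e(J(T,\psi))>0$ and $(e(J)/e(F))\vec e_{V(F)}-\vec z_{T,\psi}$ is a non-negative linear combination of the vectors $\vec x_{R_1,R_2,R_3}$. A graphon is a symmetric measurable $W:[0,1]^2\to[0,1]$, and $t(H,W):=\int_{[0,1]^{V(H)}}\prod_{uv\in E(H)}W(x_u,x_v)\prod_{v}dx_v$. For $p_1,p_2\in(0,1)$ with $p_1+p_2=1$, a pair $(H_1,H_2)$ of graphs with at least one edge each is $(p_1,p_2)$-common if for all graphons $W_1,W_2$ with $W_1+W_2=1$, \[\frac{t(H_1,W_1)}{e(H_1)p_1^{e(H_1)-1}}+\frac{t(H_2,W_2)}{e(H_2)p_2^{e(H_2)-1}}\geq \frac{p_1}{e(H_1)}+\frac{p_2}{e(H_2)}.\] *)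

(* Defs.v *)
From HB Require Import structures.
From mathcomp Require Import all_boot all_order all_algebra all_fingroup.
From mathcomp Require Import all_classical all_reals all_analysis.

Set Implicit Arguments.
Unset Strict Implicit.
Unset Printing Implicit Defensive.

Import Order.TTheory GRing.Theory Num.Theory.
Import numFieldNormedType.Exports.

Local Open Scope ring_scope.

Record sgraph := SGraph {
  vertex :> finType;
  adj : rel vertex;
  adj_sym : symmetric adj;
  adj_irrefl : irreflexive adj }.

Definition edges (G : sgraph) : {set {set G}} :=
  [set [set p.1; p.2] | p in [pred p : G * G | adj p.1 p.2]].

Definition nedges (G : sgraph) : nat := #|edges G|.

Definition components (G : sgraph) : {set {set G}} :=
  equivalence_partition (connect (@adj G)) [set: G].

(* A [ucycle] of size at most 2 is not a cycle of the graph: [:: x; y] is one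
   as soon as x and y are adjacent. *)
Definition is_tree (G : sgraph) : Prop :=
  [/\ (0 < #|G|)%N,
      (forall x y : G, connect (@adj G) x y) &
      (forall c : seq G, ucycle (@adj G) c -> (size c <= 2)%N)].

Definition isomorphic (G H : sgraph) : Prop :=
  exists2 f : G -> H, bijective f & forall x y, adj (f x) (f y) = adj x y.

Definition automorphism (G : sgraph) (f : {perm G}) : bool :=
  [forall x, forall y, adj (f x) (f y) == adj x y].

Section InducedSubgraph.
Variables (G : sgraph) (A : {set G}).

Definition induced_adj : rel {x : G | x \in A} :=
  fun x y => adj (val x) (val y).

Fact induced_sym : symmetric induced_adj.
Proof. by move=> x y; exact: adj_sym. Qed.

Fact induced_irrefl : irreflexive induced_adj.
Proof. by move=> x; exact: adj_irrefl. Qed.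

Definition induced : sgraph := SGraph induced_sym induced_irrefl.
End InducedSubgraph.

Definition delete_components (J : sgraph) (D : {set {set J}}) : sgraph :=
  induced (~: finset.cover D).

Definition obtained_by_deletion (J : sgraph) (l : nat) (H : sgraph) : Prop :=
  exists D2 D1 : {set {set J}},
    [/\ D2 \subset [set C in components J | #|C| == 2],
        #|D2| = l,
        D1 \subset [set C in components J | #|C| == 1] &
        isomorphic H (delete_components (D2 :|: D1))].

Section CycleGraph.
Variable m : nat.

(* The guard i != j only matters for m = 1. *)
Definition cycle_adj : rel 'I_m := fun i j =>
  (i != j) && ((j == i.+1 %% m :> nat) || (i == j.+1 %% m :> nat))%N.

Fact cycle_sym : symmetric cycle_adj.
Proof. by move=> i j; rewrite /cycle_adj eq_sym orbC. Qed.

Fact cycle_irrefl : irreflexive cycle_adj.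
Proof. by move=> i; rewrite /cycle_adj eqxx. Qed.

Definition cycle_graph : sgraph := SGraph cycle_sym cycle_irrefl.
End CycleGraph.

(* The map psi is split into its restrictions to V(T) and to E(T); only the
   values of [psiE] on [edges tree] are ever used. *)
Record template (F : sgraph) := Template {
  tree : sgraph;
  treeP : is_tree tree;
  psiV : tree -> {set F};
  psiE : {set tree} -> {set F};
  psi_sub : forall s t : tree, adj s t ->
    psiE [set s; t] \subset psiV s :&: psiV t }.
Arguments psiV {F} _ _.
Arguments psiE {F} _ _.

Section GluedGraph.
Variables (F : sgraph) (P : template F).

(* The pair (s, v) stands for the vertex of F_s corresponding to v. *)
Definition copies : {set tree P * F} := [set p | p.2 \in psiV P p.1].

Definition identified : rel (tree P * F) := fun p q =>
  [&& adj p.1 q.1, p.2 == q.2 & p.2 \in psiE P [set p.1; q.1]].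

Definition glued_classes : {set {set tree P * F}} :=
  equivalence_partition (connect identified) copies.

Definition glued_adj : rel {A : {set tree P * F} | A \in glued_classes} :=
  fun A B => [exists s, exists u, exists v,
    [&& (s, u) \in val A, (s, v) \in val B & adj u v]].

Fact glued_sym : symmetric glued_adj.
Proof.
have imp A B : glued_adj A B -> glued_adj B A.
  case/existsP=> s /existsP[u /existsP[v /and3P[su sv uv]]].
  apply/existsP; exists s; apply/existsP; exists v; apply/existsP; exists u.
  by rewrite su sv adj_sym.
by move=> A B; apply/idP/idP; exact: imp.
Qed.

Fact connect_identified p q : connect identified p q -> p.2 = q.2.
Proof.
case/connectP=> c; elim: c p => [|r c IHc] p /=; first by move=> _ ->.
by case/andP=> /and3P[_ /eqP-> _] pc /(IHc _ pc).
Qed.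

Fact glued_irrefl : irreflexive glued_adj.
Proof.
case=> A /= AJ; apply/negbTE/negP=> /existsP[s /existsP[u /existsP[v /and3P[/=]]]].
case/imsetP: AJ => p _ ->; rewrite !inE => /andP[_ pu] /andP[_ pv].
have /= <- := connect_identified pu; have /= <- := connect_identified pv.
by rewrite adj_irrefl.
Qed.

Definition glued : sgraph := SGraph glued_sym glued_irrefl.
End GluedGraph.

Section GoodTemplate.
Variables (R : realType) (F : sgraph).

Definition aut_equiv : rel {set F} := fun S1 S2 =>
  [exists f : {perm F}, automorphism f && (f @: S1 == S2)].

Definition aut_classes : {set {set {set F}}} :=
  equivalence_partition aut_equiv [set S : {set F} | S != finset.set0].

Definition aut_class := {C : {set {set F}} | C \in aut_classes}.

Definition class_space := {ffun aut_class -> R}.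

Definition evec (S : {set F}) : class_space :=
  if S == finset.set0 then 0 else [ffun C : aut_class => (S \in val C)%:R].

Definition zvec (P : template F) : class_space :=
  \sum_(s : tree P) evec (psiV P s) - \sum_(e in edges (tree P)) evec (psiE P e).

Definition xvec (R1 R2 R3 : {set F}) : class_space :=
  evec (R1 :|: R2 :|: R3) - evec (R2 :|: R3) - evec (R1 :|: R2) + evec R2.

Definition disjoint3 (r : {set F} * {set F} * {set F}) : bool :=
  [&& [disjoint r.1.1 & r.1.2], [disjoint r.1.1 & r.2] &
      [disjoint r.1.2 & r.2]].

Definition good (P : template F) : Prop :=
  (0 < nedges (glued P))%N /\
  exists2 c : {set F} * {set F} * {set F} -> R,
    (forall r, 0 <= c r) &
    ((nedges (glued P))%:R / (nedges F)%:R) *: evec [set: F] - zvec P =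
      \sum_(r | disjoint3 r) c r *: xvec r.1.1 r.1.2 r.2.
End GoodTemplate.

Local Open Scope classical_set_scope.

Section UnitCubeMeasure.
Variable R : realType.
Local Notation mR := (measurableTypeR R).

Definition tuple_cons (n : nat) (p : mR * n.-tuple mR) : n.+1.-tuple mR :=
  [tuple of p.1 :: p.2].

Fact measurable_tuple_cons n : measurable_fun setT (@tuple_cons n).
Proof. exact: measurable_cons. Qed.

HB.instance Definition _ n :=
  isMeasurableFun.Build _ _ _ _ (@tuple_cons n) (@measurable_tuple_cons n).

(* The n-fold product of the Lebesgue measure of [0, 1]. *)
Fixpoint cube_prob (n : nat) : probability (n.-tuple mR) R :=
  if n is k.+1 then
    distribution (uniform_prob (@ltr01 R) \x cube_prob k)%E (@tuple_cons k)
  else dirac ([tuple] : 0.-tuple mR).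
End UnitCubeMeasure.

Section Graphons.
Variable R : realType.
Local Notation mR := (measurableTypeR R).

Definition unit_square : set (mR * mR) := `[0, 1] `*` `[0, 1].

(* Only the restriction of W to the unit square is relevant. *)
Definition graphon (W : mR * mR -> R) : Prop :=
  [/\ measurable_fun unit_square W,
      (forall x y, unit_square (x, y) -> W (x, y) = W (y, x)) &
      (forall z, unit_square z -> 0 <= W z <= 1)].

(* The vertex u has the coordinate of index [enum_rank u].  Each edge uv is
   counted once, oriented by the enumeration of the vertices; for symmetric W
   the orientation is irrelevant. *)
Definition hom_density (H : sgraph) (W : mR * mR -> R) : R :=
  \int[cube_prob R #|H|]_(x in [set x | forall i, 0 <= tnth x i <= 1])
    \prod_(p : H * H | adj p.1 p.2 && (enum_rank p.1 < enum_rank p.2)%N)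
      W (tnth x (enum_rank p.1), tnth x (enum_rank p.2)).

Definition common (p1 p2 : R) (H1 H2 : sgraph) : Prop :=
  [/\ (0 < nedges H1)%N, (0 < nedges H2)%N &
    forall W1 W2 : mR * mR -> R, graphon W1 -> graphon W2 ->
      (forall z, unit_square z -> W1 z + W2 z = 1) ->
      p1 / (nedges H1)%:R + p2 / (nedges H2)%:R <=
      hom_density H1 W1 / ((nedges H1)%:R * p1 ^+ (nedges H1).-1) +
      hom_density H2 W2 / ((nedges H2)%:R * p2 ^+ (nedges H2).-1)].
End Graphons.

(* Main.v *)
Require Import Defs.
From HB Require Import structures.
From mathcomp Require Import all_boot all_order all_algebra all_fingroup.
From mathcomp Require Import all_classical all_reals all_analysis.
From mathcomp Require Import measurable_realfun.
From mathcomp Require Import polyrcf ring lra zify.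
From mathcomp Require Import fintype finset.

Set Implicit Arguments.
Unset Strict Implicit.
Unset Printing Implicit Defensive.

Import Order.TTheory GRing.Theory Num.Theory.
Import numFieldNormedType.Exports.
Local Open Scope ring_scope.

(**
The inequality to prove is linear in the homomorphism densities.  It therefore
suffices to prove it for finite weighted graphs: evaluating W1 and W2 at n
uniform random points gives such graphs, and the expected densities differ from
those of W1 and W2 by O(1/n), the proportion of non-injective maps.

For a finite weight w, let c, d, t be the densities of C_m, K_2 and H.
- The entropy method gives t(J) >= c^(e(J)/m).  Choose a map C_m -> V at random,
  with probability proportional to its weight, and glue copies of it along the
  tree, each new copy being coupled with its neighbour so as to agree with it on
  psi(st) and to be otherwise independent of it.  The entropy of the resulting
  map J -> V is the value at z_(T,psi) of a functional that is nonpositive on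
  the vectors x_(R1,R2,R3) by submodularity, and Gibbs' inequality bounds the
  logarithm of the total weight of the maps J -> V from below.  As
  t(J) = t d^l, this reads (t d^l)^m >= c^(e(H)+l).
- By the weighted AM-GM inequality, (e + l) c / p^m is at most
  m t / p^e + l (d / p)^m + (e - m), where e = e(H) >= m.
- For w1 + w2 = 1 and m odd, c1 + c2 >= d1^m + d2^m: with A the matrix of w1
  and u the normalised constant vector, the derivative in s of
  - tr (A - s u u^T)^m is m u^T (A - s u u^T)^(m-1) u >= m (d1 - s)^(m-1).
The balance condition makes the coefficients of c1 and c2 equal, and Bernoulli's
inequality concludes.
*)

(** * Means over finite types *)

Section Mean.
Variable R : numFieldType.
Implicit Types S T : finType.

Definition mean T (f : T -> R) : R := (\sum_x f x) / #|T|%:R.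

Lemma eq_mean T (f g : T -> R) : f =1 g -> mean f = mean g.
Proof. by move=> fg; congr (_ / _); apply: eq_bigr. Qed.

Lemma mean_ge0 T (f : T -> R) : (forall x, 0 <= f x) -> 0 <= mean f.
Proof. by move=> f_ge0; rewrite divr_ge0 ?sumr_ge0. Qed.

Lemma meanD T (f g : T -> R) : mean (fun x => f x + g x) = mean f + mean g.
Proof. by rewrite -mulrDl -big_split. Qed.

Lemma mean_sum T (I : finType) (P : pred I) (f : I -> T -> R) :
  mean (fun x => \sum_(i | P i) f i x) = \sum_(i | P i) mean (f i).
Proof. by rewrite /mean -mulr_suml exchange_big. Qed.

Lemma ler_mean T (f g : T -> R) : (forall x, f x <= g x) -> mean f <= mean g.
Proof. by move=> fg; rewrite ler_wpM2r ?invr_ge0 ?ler0n// ler_sum. Qed.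

Lemma mean_cst T (c : R) : (0 < #|T|)%N -> mean (fun _ : T => c) = c.
Proof.
move=> T_gt0; rewrite /mean sumr_const -[c *+ _]mulr_natr mulfK//.
by rewrite pnatr_eq0 -lt0n.
Qed.

Lemma mean_bij S T (h : S -> T) (f : T -> R) :
  bijective h -> mean (f \o h) = mean f.
Proof.
move=> h_bij; rewrite /mean (bij_eq_card h_bij) [in RHS](reindex h)//.
exact: onW_bij.
Qed.

Lemma mean_prod S T (f : S -> R) (g : T -> R) :
  mean (fun p : S * T => f p.1 * g p.2) = mean f * mean g.
Proof.
rewrite /mean card_prod natrM mulf_div big_distrlr pair_bigA.
by congr (_ / _); apply: eq_bigr => -[].
Qed.

Lemma mean_fst S T (f : S -> R) :
  (0 < #|T|)%N -> mean (fun p : S * T => f p.1) = mean f.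
Proof.
move=> T_gt0; rewrite -[RHS]mulr1 -(mean_cst 1 T_gt0) -mean_prod.
by apply: eq_mean => p; rewrite mulr1.
Qed.

Lemma mean_snd S T (g : T -> R) :
  (0 < #|S|)%N -> mean (fun p : S * T => g p.2) = mean g.
Proof.
move=> S_gt0; rewrite -[RHS]mul1r -(mean_cst 1 S_gt0) -mean_prod.
by apply: eq_mean => p; rewrite mul1r.
Qed.

End Mean.

Section MeanFfun.
Variables (R : numFieldType) (V : finType).
Hypothesis V_gt0 : (0 < #|V|)%N.

Definition precomp (A B : finType) (h : A -> B) (phi : {ffun B -> V}) :
    {ffun A -> V} := [ffun a => phi (h a)].

Lemma precomp_perm_bij (A : finType) (f : {perm A}) : bijective (precomp f).
Proof.
by exists (precomp f^-1%g) => phi; apply/ffunP => a; rewrite !ffunE (permK, permKV).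
Qed.

Lemma card_ffun_gt0 (A : finType) : (0 < #|{ffun A -> V}|)%N.
Proof. by rewrite card_ffun expn_gt0 V_gt0. Qed.

(* Exchanging the values of phi on the range of h with those of psi is an
   involution of the set of pairs (phi, psi). *)
Lemma mean_ffun_inj (A B : finType) (h : A -> B) (f : {ffun A -> V} -> R) :
  injective h -> mean (f \o precomp h) = mean f.
Proof.
move=> h_inj.
pose ins (phi : {ffun B -> V}) (psi : {ffun A -> V}) : {ffun B -> V} :=
  [ffun b => if [pick a | h a == b] is Some a then psi a else phi b].
have precomp_ins phi psi : precomp h (ins phi psi) = psi.
  apply/ffunP => a; rewrite !ffunE.
  by case: pickP => [a' /eqP/h_inj->|/(_ a)/eqP].
have ins_precomp phi psi : ins (ins phi psi) (precomp h phi) = phi.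
  by apply/ffunP => b; rewrite !ffunE; case: pickP => // a /eqP <-; rewrite ffunE.
pose exchange (p : {ffun B -> V} * {ffun A -> V}) := (ins p.1 p.2, precomp h p.1).
have exchangeK : involutive exchange.
  by case=> phi psi; rewrite /exchange/= ins_precomp precomp_ins.
rewrite -(mean_fst _ (card_ffun_gt0 A)) -[RHS](mean_snd _ (card_ffun_gt0 B)).
by rewrite -[RHS](mean_bij _ (inv_bij exchangeK)).
Qed.

Lemma mean_ffun_indep (B : finType) (S : {set B}) (f g : {ffun B -> V} -> R) :
  (forall phi psi : {ffun B -> V}, {in S, phi =1 psi} -> f phi = f psi) ->
  (forall phi psi : {ffun B -> V}, {in ~: S, phi =1 psi} -> g phi = g psi) ->
  mean (fun phi => f phi * g phi) = mean f * mean g.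
Proof.
move=> f_local g_local; pose mix (phi psi : {ffun B -> V}) : {ffun B -> V} :=
  [ffun b => if b \in S then phi b else psi b].
pose exchange p := (mix p.1 p.2, mix p.2 p.1).
have exchangeK : involutive exchange.
  case=> phi psi; rewrite /exchange/=.
  by congr (_, _); apply/ffunP => b; rewrite !ffunE; case: (b \in S).
rewrite -(mean_fst _ (card_ffun_gt0 B)) -mean_prod.
rewrite -[RHS](mean_bij _ (inv_bij exchangeK)); apply: eq_mean => -[phi psi] /=.
congr (_ * _); [apply: f_local|apply: g_local] => b.
  by rewrite ffunE => ->.
by rewrite inE ffunE => /negbTE->.
Qed.

End MeanFfun.

(** * Edge products and densities *)

Lemma set2_eq (T : finType) (a b x y : T) :
  [set a; b] = [set x; y] -> (a = x /\ b = y) \/ (a = y /\ b = x).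
Proof.
move=> abxy; have /set2P a_xy : a \in [set x; y] by rewrite -abxy set21.
have /set2P b_xy : b \in [set x; y] by rewrite -abxy set22.
have /set2P x_ab : x \in [set a; b] by rewrite abxy set21.
have /set2P y_ab : y \in [set a; b] by rewrite abxy set22.
by case: a_xy b_xy x_ab y_ab => -> [->|->] [xE|xE] [yE|yE]; auto.
Qed.

Definition embedding (G H : sgraph) (h : G -> H) : Prop :=
  injective h /\ forall x y, adj (h x) (h y) = adj x y.

Section Edges.
Variable G : sgraph.
Implicit Types (x y : G) (e A B : {set G}).

Lemma adj_neq x y : adj x y -> x != y.
Proof. by apply: contraTneq => ->; rewrite adj_irrefl. Qed.

Lemma edgesP e :
  reflect (exists x y, adj x y /\ e = [set x; y]) (e \in edges G).
Proof.
apply: (iffP imsetP) => [[[x y] xy ->]|[x [y [xy ->]]]]; first by exists x, y.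
by exists (x, y).
Qed.

Lemma mem_edges x y : ([set x; y] \in edges G) = adj x y.
Proof.
apply/edgesP/idP => [[a [b [ab xyE]]]|xy]; last by exists x, y.
by case: (set2_eq xyE) => -[-> ->]; rewrite // adj_sym.
Qed.

Lemma card_edge e : e \in edges G -> #|e| = 2.
Proof. by case/edgesP => x [y [xy ->]]; rewrite cards2 adj_neq. Qed.

Lemma edge_sub1 x e : e \in edges G -> (e \subset [set x]) = false.
Proof.
move=> eG; apply/negP => /subset_leq_card.
by rewrite cards1 card_edge.
Qed.

Lemma edge_sub2 x y e :
  adj x y -> e \in edges G -> (e \subset [set x; y]) = (e == [set x; y]).
Proof. by move=> xy eG; rewrite eqEcard cards2 adj_neq// card_edge// andbT. Qed.

Lemma edge_subU A B e :
  (forall x y, x \in A -> y \in B -> ~~ adj x y) -> e \in edges G ->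
  (e \subset A :|: B) = (e \subset A) || (e \subset B).
Proof.
move=> nadj /edgesP[x [y [xy ->]]]; rewrite !subUset !sub1set !inE.
have := nadj x y; have := nadj y x; rewrite [adj y x]adj_sym xy.
by case: (x \in A) (x \in B) (y \in A) (y \in B) => [] [] [] [] //= yx xy';
  do ?[by have := yx isT isT|by have := xy' isT isT].
Qed.

Lemma edge_sub_disjoint A B e : [disjoint A & B] -> e \in edges G ->
  e \subset A -> (e \subset B) = false.
Proof.
move=> disjAB eG eA; apply/negP => eB; have := card_edge eG.
suff -> : e = set0 by rewrite cards0.
by apply/eqP; rewrite -subset0 -(disjoint_setI0 disjAB) subsetI eA.
Qed.

End Edges.

Lemma edges_embed (G H : sgraph) (h : G -> H) : embedding h ->
  [set e in edges H | e \subset h @: [set: G]] = [set h @: e | e : {set G} in edges G].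
Proof.
move=> [_ h_adj]; apply/setP => e; rewrite inE.
apply/andP/imsetP => [[/edgesP[a [b [ab ->]]]]|[e' e'G ->]].
  rewrite subUset !sub1set => /andP[/imsetP[x _ hx] /imsetP[y _ hy]].
  exists [set x; y]; last by rewrite imsetU1 imset_set1 hx hy.
  by rewrite mem_edges -h_adj -hx -hy.
rewrite imsetS ?subsetT//; split=> //.
have /edgesP[x [y [xy ->]]] := e'G.
by rewrite imsetU1 imset_set1 mem_edges h_adj.
Qed.

Section EdgeProduct.
Variables (R : comNzRingType) (U : Type) (w : U -> U -> R).

(* For symmetric w the orientation of the edge e picked here is irrelevant, and
   so is the value 1 taken when e is not an edge. *)
Definition edge_weight (G : sgraph) (phi : G -> U) (e : {set G}) : R :=
  if [pick p : G * G | adj p.1 p.2 && (e == [set p.1; p.2])] is Some p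
  then w (phi p.1) (phi p.2) else 1.

Definition edge_prod_on (G : sgraph) (A : {set G}) (phi : G -> U) : R :=
  \prod_(e in edges G | e \subset A) edge_weight phi e.

Definition edge_prod (G : sgraph) (phi : G -> U) : R :=
  \prod_(e in edges G) edge_weight phi e.

Lemma edge_prod_onT (G : sgraph) (phi : G -> U) :
  edge_prod_on [set: G] phi = edge_prod phi.
Proof. by apply: eq_bigl => e; rewrite subsetT andbT. Qed.

Lemma edge_prod_onU (G : sgraph) (A B : {set G}) (phi : G -> U) :
  [disjoint A & B] -> (forall x y, x \in A -> y \in B -> ~~ adj x y) ->
  edge_prod_on (A :|: B) phi = edge_prod_on A phi * edge_prod_on B phi.
Proof.
move=> disjAB nadj.
rewrite /edge_prod_on (bigID (fun e : {set G} => e \subset A))/=.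
congr (_ * _); apply: eq_bigl => e; have [eG|//] := boolP (e \in edges G);
  rewrite /= edge_subU//; have [eA|//] := boolP (e \subset A); rewrite ?andbT ?andbF//=.
by rewrite (edge_sub_disjoint disjAB eG eA).
Qed.

Lemma eq_edge_weight (G : sgraph) (phi psi : G -> U) (e : {set G}) :
  {in e, phi =1 psi} -> edge_weight phi e = edge_weight psi e.
Proof.
rewrite /edge_weight => eq_e; case: pickP => // -[x y] /andP[_ /eqP eE].
by rewrite !eq_e// eE ?set21 ?set22.
Qed.

Lemma eq_in_edge_prod_on (G : sgraph) (A : {set G}) (phi psi : G -> U) :
  {in A, phi =1 psi} -> edge_prod_on A phi = edge_prod_on A psi.
Proof.
move=> eqA; apply: eq_bigr => e /andP[_ /subsetP eA].
by apply: eq_edge_weight => x /eA/eqA.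
Qed.

Lemma eq_edge_prod (G : sgraph) (phi psi : G -> U) :
  phi =1 psi -> edge_prod phi = edge_prod psi.
Proof.
by move=> eq_phi; apply: eq_bigr => e _; apply: eq_edge_weight => x _.
Qed.

Hypothesis w_sym : commutative w.

Lemma edge_weightE (G : sgraph) (phi : G -> U) (x y : G) :
  adj x y -> edge_weight phi [set x; y] = w (phi x) (phi y).
Proof.
move=> xy; rewrite /edge_weight; case: pickP => [[a b]|/(_ (x, y))]; last first.
  by rewrite /= xy eqxx.
by case/andP=> _ /eqP/set2_eq[] [-> ->].
Qed.

Lemma edge_weight_imset (G H : sgraph) (h : G -> H) (phi : H -> U) (e : {set G}) :
  embedding h -> e \in edges G ->
  edge_weight phi (h @: e) = edge_weight (phi \o h) e.
Proof.
move=> [_ h_adj] /edgesP[x [y [xy ->]]].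
by rewrite imsetU1 imset_set1 !edge_weightE// h_adj.
Qed.

Lemma edge_prod_embed (G H : sgraph) (h : G -> H) (phi : H -> U) :
  embedding h -> edge_prod (phi \o h) = edge_prod_on (h @: [set: G]) phi.
Proof.
move=> h_emb; rewrite /edge_prod_on -big_set/= edges_embed// big_imset/=.
  by apply: eq_bigr => e eG; rewrite edge_weight_imset.
by move=> e e' _ _; apply: imset_inj; case: h_emb.
Qed.

Lemma edge_prod_oriented (G : sgraph) (phi : G -> U) :
  \prod_(p : G * G | adj p.1 p.2 && (enum_rank p.1 < enum_rank p.2)%N)
    w (phi p.1) (phi p.2) = edge_prod phi.
Proof.
pose arcs := [set p : G * G | adj p.1 p.2 && (enum_rank p.1 < enum_rank p.2)%N].
have edgesE : edges G = [set [set p.1; p.2] | p in arcs].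
  apply/setP => e; apply/edgesP/imsetP => [[x [y [xy ->]]]|[[x y]]]; last first.
    by rewrite inE => /andP[xy _] ->; exists x, y.
  have := adj_neq xy; rewrite -(inj_eq enum_rank_inj) -(inj_eq val_inj) neq_ltn.
  case/orP=> [lt_xy|lt_yx]; first by exists (x, y); rewrite // inE xy.
  by exists (y, x); rewrite 1?setUC// inE adj_sym xy.
rewrite /edge_prod edgesE big_imset/=; last first.
  move=> [x y] [x' y']; rewrite !inE/= => /andP[_ lt_xy] /andP[_ lt_xy'].
  case/set2_eq=> -[xE yE]; first by rewrite xE yE.
  by move: lt_xy; rewrite xE yE ltnNge ltnW.
rewrite -big_set; apply: eq_bigr => -[x y]; rewrite inE => /andP[xy _].
by rewrite edge_weightE.
Qed.

End EdgeProduct.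

Lemma edge_prod_cst (R : comNzRingType) (U : Type) (G : sgraph) (phi : G -> U)
    (c : R) :
  edge_prod (fun _ _ => c) phi = c ^+ nedges G.
Proof.
rewrite /edge_prod -prodr_const; apply: eq_bigr => e /edgesP[x [y [xy ->]]].
by rewrite edge_weightE.
Qed.

Section EdgeProductOrder.
Variables (R : numDomainType) (U : Type) (w : U -> U -> R).
Hypothesis w_ge0 : forall x y, 0 <= w x y.

Lemma edge_weight_ge0 (G : sgraph) (phi : G -> U) (e : {set G}) :
  0 <= edge_weight w phi e.
Proof. by rewrite /edge_weight; case: pickP. Qed.

Lemma edge_prod_ge0 (G : sgraph) (phi : G -> U) : 0 <= edge_prod w phi.
Proof. by apply: prodr_ge0 => e _; exact: edge_weight_ge0. Qed.

Lemma edge_prod_le1 (G : sgraph) (phi : G -> U) :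
  (forall x y, w x y <= 1) -> edge_prod w phi <= 1.
Proof.
move=> w_le1; apply: prodr_ile1 => e _; rewrite edge_weight_ge0/=.
by rewrite /edge_weight; case: pickP.
Qed.

End EdgeProductOrder.

Section Density.
Variables (R : numFieldType) (V : finType) (w : V -> V -> R).

Definition dens (G : sgraph) : R :=
  mean (fun phi : {ffun G -> V} => edge_prod w phi).

Definition dens_on (G : sgraph) (A : {set G}) : R :=
  mean (fun phi : {ffun G -> V} => edge_prod_on w A phi).

Definition edge_dens : R := mean (fun p : V * V => w p.1 p.2).

Lemma dens_onT (G : sgraph) : dens_on [set: G] = dens G.
Proof. by apply: eq_mean => phi; exact: edge_prod_onT. Qed.

Lemma dens_ge0 (G : sgraph) : (forall x y, 0 <= w x y) -> 0 <= dens G.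
Proof. by move=> w_ge0; apply: mean_ge0 => phi; exact: edge_prod_ge0. Qed.

Lemma edge_dens_ge0 : (forall x y, 0 <= w x y) -> 0 <= edge_dens.
Proof. by move=> w_ge0; exact: mean_ge0. Qed.

Hypothesis V_gt0 : (0 < #|V|)%N.

Lemma edge_densE (T : finType) (x y : T) : x != y ->
  mean (fun phi : {ffun T -> V} => w (phi x) (phi y)) = edge_dens.
Proof.
move=> xNy; pose h (b : bool) := if b then x else y.
have h_inj : injective h.
  by case=> [] [] //= /eqP; rewrite ?(negbTE xNy)// eq_sym (negbTE xNy).
pose pair_of (psi : {ffun bool -> V}) := (psi true, psi false).
pose ffun_of (p : V * V) : {ffun bool -> V} := [ffun b => if b then p.1 else p.2].
have pair_of_bij : bijective pair_of.
  exists ffun_of => [psi|[a b]]; last by rewrite /pair_of !ffunE.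
  by apply/ffunP => -[]; rewrite ffunE.
rewrite /edge_dens -(mean_bij _ pair_of_bij) -(mean_ffun_inj V_gt0 _ h_inj).
by apply: eq_mean => phi; rewrite /= !ffunE.
Qed.

Lemma dens_onU (G : sgraph) (A B : {set G}) :
  [disjoint A & B] -> (forall x y, x \in A -> y \in B -> ~~ adj x y) ->
  dens_on (A :|: B) = dens_on A * dens_on B.
Proof.
move=> disjAB nadj; rewrite -(mean_ffun_indep V_gt0 (S := A)).
- by apply: eq_mean => phi; rewrite edge_prod_onU.
- by move=> phi psi; exact: eq_in_edge_prod_on.
- move=> phi psi eqCA; apply: eq_in_edge_prod_on => x xB; apply: eqCA.
  by rewrite inE (disjointFl disjAB).
Qed.

Lemma dens_on_indep (G : sgraph) (A : {set G}) :
  (forall e, e \in edges G -> (e \subset A) = false) -> dens_on A = 1.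
Proof.
move=> indepA; rewrite -[RHS](mean_cst 1 (card_ffun_gt0 V_gt0 G)).
apply: eq_mean => phi; rewrite /edge_prod_on big_pred0// => e.
by have [/indepA|] := boolP (e \in edges G).
Qed.

Lemma dens_on0 (G : sgraph) : dens_on (set0 : {set G}) = 1.
Proof.
apply: dens_on_indep => e eG; rewrite subset0 -cards_eq0.
by rewrite (card_edge eG).
Qed.

Lemma dens_on1 (G : sgraph) (x : G) : dens_on [set x] = 1.
Proof. by apply: dens_on_indep => e; exact: edge_sub1. Qed.

Hypothesis w_sym : commutative w.

Lemma dens_on2 (G : sgraph) (x y : G) : adj x y -> dens_on [set x; y] = edge_dens.
Proof.
move=> xy; rewrite -(edge_densE (adj_neq xy)); apply: eq_mean => phi.
rewrite /edge_prod_on (big_pred1 [set x; y]) ?edge_weightE// => e /=.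
have [eG|eNG] := boolP (e \in edges G); first by rewrite edge_sub2.
by apply/esym/negP => /eqP eE; rewrite eE mem_edges xy in eNG.
Qed.

Lemma dens_embed (G H : sgraph) (h : G -> H) :
  embedding h -> dens G = dens_on (h @: [set: G]).
Proof.
move=> h_emb; have [h_inj _] := h_emb.
rewrite /dens -(mean_ffun_inj V_gt0 _ h_inj); apply: eq_mean => phi.
by rewrite /= -edge_prod_embed//; apply: eq_edge_prod => x; rewrite ffunE.
Qed.

End Density.

Lemma edge_dens_cst (R : numFieldType) (V : finType) (c : R) :
  (0 < #|V|)%N -> edge_dens (fun _ _ : V => c) = c.
Proof. by move=> V_gt0; apply: mean_cst; rewrite card_prod muln_gt0 V_gt0. Qed.

Lemma edge_dens_complement (R : numFieldType) (V : finType) (w1 w2 : V -> V -> R) :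
  (0 < #|V|)%N -> (forall x y, w1 x y + w2 x y = 1) ->
  edge_dens w1 + edge_dens w2 = 1.
Proof.
move=> V_gt0 w12; rewrite -meanD -(edge_dens_cst 1 V_gt0).
by apply: eq_mean => p; exact: w12.
Qed.

Lemma dens_cst (R : numFieldType) (V : finType) (G : sgraph) (c : R) :
  (0 < #|V|)%N -> dens (fun _ _ : V => c) G = c ^+ nedges G.
Proof.
move=> V_gt0; rewrite -[RHS](mean_cst _ (card_ffun_gt0 V_gt0 G)).
by apply: eq_mean => phi; rewrite edge_prod_cst.
Qed.

(** * Deletion of components *)

Section Components.
Variable G : sgraph.
Implicit Types (x y : G) (C D : {set G}).

Lemma components_partition : partition (components G) [set: G].
Proof.
apply: equivalence_partitionP => x y z _ _ _; split=> // xy.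
exact: (same_connect (sym_connect_sym (@adj_sym G))).
Qed.

Lemma component_closed C x y :
  C \in components G -> x \in C -> adj x y -> y \in C.
Proof.
case/imsetP => z _ ->; rewrite !inE /= => zx xy.
by apply: connect_trans zx (connect1 xy).
Qed.

Lemma cover_components_closed (P : {set {set G}}) x y :
  P \subset components G -> x \in cover P -> adj x y -> y \in cover P.
Proof.
move=> /subsetP PG /bigcupP[C CP xC] xy; apply/bigcupP; exists C => //.
exact: component_closed (PG _ CP) xC xy.
Qed.

Lemma components_disjoint C D :
  C \in components G -> D \in components G -> C != D -> [disjoint C & D].
Proof.
by move=> CG DG; apply: (trivIsetP (partition_trivIset components_partition)).
Qed.

Lemma component2_adj C : C \in components G -> #|C| = 2 ->
  exists x y, C = [set x; y] /\ adj x y.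
Proof.
move=> CG /eqP/cards2P[x [y [xNy CE]]]; exists x, y; split=> //.
have [xC yC] : x \in C /\ y \in C by rewrite CE set21 set22.
have /connectP[[|z p] /= x_path yE] : connect (@adj G) x y.
- case/imsetP: CG xC yC => z _ ->; rewrite !inE /= => zx zy.
  by rewrite -(same_connect (sym_connect_sym (@adj_sym G)) zx).
- by rewrite yE eqxx in xNy.
case/andP: x_path => xz _; have := component_closed CG xC xz.
by rewrite CE => /set2P[] zE; move: xz; rewrite zE ?adj_irrefl.
Qed.

End Components.

Section Deletion.
Variables (R : numFieldType) (V : finType) (w : V -> V -> R).
Hypothesis V_gt0 : (0 < #|V|)%N.

Lemma dens_on_cover (G : sgraph) (P : {set {set G}}) : P \subset components G ->
  dens_on w (cover P) = \prod_(C in P) dens_on w C.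
Proof.
have [k] := ubnP #|P|; elim: k => // k IHk in P * => ltPk /subsetP PG.
have [->|[C CP]] := set_0Vmem P; first by rewrite /cover !big_set0 dens_on0.
have PCG : P :\ C \subset components G.
  by apply/subsetP => D; rewrite inE => /andP[_ /PG].
have disjC : [disjoint C & cover (P :\ C)].
  apply/bigcup_disjointP => D; rewrite !inE => /andP[DNC DP].
  by rewrite disjoint_sym components_disjoint ?PG.
rewrite (big_setD1 C CP)/= -IHk//; last by move: ltPk; rewrite (cardsD1 C) CP.
rewrite -dens_onU//; first by rewrite /cover (big_setD1 C CP).
move=> x y xC yP; apply/negP; rewrite adj_sym => yx.
by have := disjointFr disjC xC; rewrite (cover_components_closed PCG yP yx).
Qed.

Hypothesis w_sym : commutative w.

Lemma dens_on_components2 (G : sgraph) (P : {set {set G}}) :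
  P \subset [set C in components G | #|C| == 2] ->
  \prod_(C in P) dens_on w C = edge_dens w ^+ #|P|.
Proof.
move=> /subsetP PG; rewrite -prodr_const; apply: eq_bigr => C /PG.
rewrite inE => /andP[CG /eqP C2]; have [x [y [-> xy]]] := component2_adj CG C2.
exact: dens_on2.
Qed.

Lemma dens_on_components1 (G : sgraph) (P : {set {set G}}) :
  P \subset [set C in components G | #|C| == 1] ->
  \prod_(C in P) dens_on w C = 1.
Proof.
move=> /subsetP PG; rewrite big1// => C /PG.
by rewrite inE => /andP[_ /cards1P[x ->]]; exact: dens_on1.
Qed.

Lemma dens_delete_components (G H : sgraph) (P : {set {set G}}) :
  P \subset components G -> isomorphic H (delete_components P) ->
  dens w G = dens w H * dens_on w (cover P).
Proof.
move=> PG [f f_bij f_adj]; pose h (x : H) : G := val (f x).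
have h_emb : embedding h.
  by split=> [x y /val_inj/(bij_inj f_bij)|x y]; rewrite // -f_adj.
have h_codom : h @: [set: H] = ~: cover P.
  have [g _ gK] := f_bij; apply/setP => x; apply/imsetP/idP => [[y _ ->]|xP].
    exact: (valP (f y)).
  by exists (g (exist _ x xP)); rewrite // /h gK.
rewrite (dens_embed V_gt0 w_sym h_emb) h_codom -dens_onU//.
- by rewrite setUC setUCr dens_onT.
- by rewrite -setI_eq0 setIC setICr.
- move=> x y; rewrite inE => xNP yP; apply: contra xNP; rewrite adj_sym.
  exact: cover_components_closed.
Qed.

Lemma dens_deletion (G H : sgraph) (l : nat) :
  obtained_by_deletion G l H -> dens w G = dens w H * edge_dens w ^+ l.
Proof.
case=> P2 [P1 [P2G <- P1G isoH]].
have sub_components (k : nat) (P : {set {set G}}) :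
    P \subset [set C in components G | #|C| == k] -> P \subset components G.
  by move=> /subset_trans; apply; apply/subsetP => C; rewrite inE => /andP[].
have delG : P2 :|: P1 \subset components G.
  by rewrite subUset (sub_components 2%N)// (sub_components 1%N).
have disjP : [disjoint P2 & P1].
  apply/pred0P => C /=; apply/andP => -[/(subsetP P2G) CP2 /(subsetP P1G)].
  by move: CP2; rewrite !inE => /andP[_ /eqP->]; rewrite andbF.
rewrite (dens_delete_components delG isoH) dens_on_cover//.
rewrite (eq_bigl [predU P2 & P1]) => [|C]; last by rewrite !inE.
by rewrite bigU//= dens_on_components2// dens_on_components1// mulr1.
Qed.

End Deletion.

(* The edges are counted by comparing densities for a constant weight. *)
Lemma nedges_deletion (G H : sgraph) (l : nat) :
  obtained_by_deletion G l H -> nedges G = (nedges H + l)%N.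
Proof.
move=> GH; have unit_gt0 : (0 < #|{: unit}|)%N by rewrite card_unit.
have := dens_deletion (w := fun _ _ : unit => 2 : rat) unit_gt0 (fun _ _ => erefl) GH.
rewrite !dens_cst// edge_dens_cst// -exprD.
by apply: ieexprIn.
Qed.

(** * A trace inequality *)

Lemma sqr_sumM_le (R : realDomainType) (I : finType) (f g : I -> R) :
  (\sum_i f i * g i) ^+ 2 <= (\sum_i f i ^+ 2) * (\sum_i g i ^+ 2).
Proof.
have lagrange : \sum_i \sum_j (f i * g j - f j * g i) ^+ 2 =
    ((\sum_i f i ^+ 2) * (\sum_i g i ^+ 2) - (\sum_i f i * g i) ^+ 2) *+ 2.
  rewrite mulr2n {1}[_ * _]mulrC expr2 !big_distrlr/=.
  rewrite -!sumrB -big_split; apply: eq_bigr => i _.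
  by rewrite -!sumrB -big_split; apply: eq_bigr => j _ /=; ring.
rewrite -subr_ge0 -(pmulrn_lge0 _ (ltn0Sn 1)) -lagrange.
by rewrite sumr_ge0// => i _; rewrite sumr_ge0// => j _; exact: sqr_ge0.
Qed.

Lemma logconvex_expr_le (R : realDomainType) (b : nat -> R) :
  b 0%N = 1 -> (forall j, 0 <= b j) ->
  (forall j, b j.+1 ^+ 2 <= b j * b j.+2) ->
  forall k, b 1%N ^+ k <= b k.
Proof.
move=> b0 b_ge0 b_logconvex.
have le_bS j : b 1%N * b j <= b j.+1.
  elim: j => [|j IHj]; first by rewrite b0 mulr1.
  have [bj0|bj_neq0] := eqVneq (b j) 0.
    have bSj0 : b j.+1 = 0.
      apply/eqP; rewrite -sqrf_eq0 eq_le sqr_ge0 andbT.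
      by have := b_logconvex j; rewrite bj0 mul0r.
    by rewrite bSj0 mulr0.
  have bj_gt0 : 0 < b j by rewrite lt0r bj_neq0 b_ge0.
  rewrite -(ler_pM2l bj_gt0) mulrCA mulrA; apply: le_trans (b_logconvex j).
  by rewrite expr2 ler_wpM2r.
elim=> [|k IHk]; first by rewrite expr0 b0.
by rewrite exprS (le_trans _ (le_bS k))// ler_wpM2l.
Qed.

Section QuadraticForm.
Variables (R : realDomainType) (n : nat).
Implicit Types (M : 'M[R]_n.+1) (u x y : 'cV[R]_n.+1).

Definition qform M u : R := (u^T *m M *m u) ord0 ord0.

Lemma sqr_dot_le x y :
  ((x^T *m y) ord0 ord0) ^+ 2 <=
  (x^T *m x) ord0 ord0 * (y^T *m y) ord0 ord0.
Proof.
have dotE (a b : 'cV[R]_n.+1) :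
    (a^T *m b) ord0 ord0 = \sum_i a i ord0 * b i ord0.
  by rewrite mxE; apply: eq_bigr => i _; rewrite mxE.
by rewrite !dotE; exact: (sqr_sumM_le (x^~ ord0) (y^~ ord0)).
Qed.

Lemma trmx_expr M k : (M ^+ k)^T = M^T ^+ k.
Proof.
elim: k => [|k IHk]; first by rewrite !expr0 trmx1.
by rewrite exprS -mulmxE trmx_mul IHk mulmxE -exprSr.
Qed.

Lemma qform_exprD M u i j : M^T = M ->
  qform (M ^+ (i + j)) u = ((M ^+ i *m u)^T *m (M ^+ j *m u)) ord0 ord0.
Proof. by move=> M_sym; rewrite /qform trmx_mul trmx_expr M_sym exprD !mulmxA. Qed.

(* The even moments u^T M^(2j) u are log-convex in j. *)
Lemma expr_qform_le M u k : M^T = M -> u^T *m u = 1%:M ->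
  qform M u ^+ (2 * k) <= qform (M ^+ (2 * k)) u.
Proof.
move=> M_sym u_unit; pose b j := qform (M ^+ (j + j)) u.
have sqr_b i j : qform (M ^+ (i + j)) u ^+ 2 <= b i * b j.
  by rewrite /b !qform_exprD// sqr_dot_le.
have b0 : b 0%N = 1 by rewrite /b /qform expr0 mulmx1 u_unit mxE.
have b_ge0 j : 0 <= b j.
  by rewrite /b qform_exprD// mxE sumr_ge0// => i _; rewrite mxE -expr2 sqr_ge0.
have b1 : qform M u ^+ 2 <= b 1%N by have := sqr_b 0%N 1%N; rewrite b0 mul1r.
rewrite exprM mul2n -addnn -/(b k); apply: le_trans (logconvex_expr_le b0 b_ge0 _ k).
  by rewrite lerXn2r ?nnegrE ?sqr_ge0.
by move=> j; have := sqr_b j j.+2; rewrite addnS -addSn.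
Qed.

End QuadraticForm.

Section MatrixPencil.
Variables (R : comNzRingType) (n : nat).

Lemma deriv_mxtrace (M : 'M[{poly R}]_n.+1) :
  (\tr M)^`() = \tr (map_mx (@deriv R) M).
Proof. by rewrite /mxtrace raddf_sum; apply: eq_bigr => i _; rewrite mxE. Qed.

Lemma map_mx_derivM (M N : 'M[{poly R}]_n.+1) :
  map_mx (@deriv R) (M * N) =
  map_mx (@deriv R) M * N + M * map_mx (@deriv R) N.
Proof.
apply/matrixP => i j; rewrite !mxE raddf_sum -big_split; apply: eq_bigr => k _.
by rewrite /= derivM !mxE.
Qed.

Lemma deriv_mxtrace_expr (M : 'M[{poly R}]_n.+1) k :
  (\tr (M ^+ k.+1))^`() = \tr (map_mx (@deriv R) M * M ^+ k) *+ k.+1.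
Proof.
have mxtraceC (N N' : 'M[{poly R}]_n.+1) : \tr (N * N') = \tr (N' * N).
  exact: mxtrace_mulC.
suff tr_deriv j i : \tr (map_mx (@deriv R) (M ^+ j.+1) * M ^+ i) =
    \tr (map_mx (@deriv R) M * M ^+ (j + i)) *+ j.+1.
  by rewrite deriv_mxtrace -[map_mx _ _]mulr1 -(expr0 M) tr_deriv addn0.
elim: j i => [|j IHj] i; first by rewrite expr1.
rewrite [M ^+ j.+2]exprS map_mx_derivM mulrDl linearD/= -!mulrA -exprD.
by rewrite (mxtraceC M) -mulrA -exprSr IHj addnS addSn -mulrS.
Qed.

Variables A B : 'M[R]_n.+1.

Definition pencil : 'M[{poly R}]_n.+1 := map_mx polyC A + 'X *: map_mx polyC B.

Lemma horner_mxtrace (M : 'M[{poly R}]_n.+1) s :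
  (\tr M).[s] = \tr (map_mx (horner_eval s) M).
Proof. by rewrite /mxtrace horner_sum; apply: eq_bigr => i _; rewrite mxE. Qed.

Lemma map_pencil s : map_mx (horner_eval s) pencil = A + s *: B.
Proof. by apply/matrixP => i j; rewrite !mxE /horner_eval !hornerE. Qed.

Lemma horner_mxtrace_pencil k s :
  (\tr (pencil ^+ k)).[s] = \tr ((A + s *: B) ^+ k).
Proof. by rewrite horner_mxtrace rmorphXn/= map_pencil. Qed.

Lemma deriv_mxtrace_pencil k s :
  (\tr (pencil ^+ k.+1))^`().[s] = \tr (B *m (A + s *: B) ^+ k) *+ k.+1.
Proof.
have pencil' : map_mx (@deriv R) pencil = map_mx polyC B.
  apply/matrixP => i j; rewrite !mxE derivD derivM derivX !derivC.
  by rewrite mul1r mulr0 addr0 add0r.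
rewrite deriv_mxtrace_expr pencil' hornerMn horner_mxtrace rmorphM rmorphXn/=.
rewrite map_pencil; congr (\tr (_ *m _) *+ _).
by apply/matrixP => i j; rewrite !mxE /horner_eval hornerE.
Qed.

End MatrixPencil.

Lemma mxtrace_rank1M (R : comNzRingType) (n : nat) (N : 'M[R]_n.+1)
    (u : 'cV[R]_n.+1) : \tr (u *m u^T *m N) = (u^T *m N *m u) ord0 ord0.
Proof. by rewrite -mulmxA mxtrace_mulC /mxtrace big_ord1. Qed.

Section RankOneUpdate.
Variables (R : rcfType) (n : nat) (A : 'M[R]_n.+1) (u : 'cV[R]_n.+1).
Hypothesis A_sym : A^T = A.
Hypothesis u_unit : u^T *m u = 1%:M.

Lemma qform_rank1_update s : qform (A - s *: (u *m u^T)) u = qform A u - s.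
Proof.
rewrite /qform mulmxBr mulmxBl -scalemxAr -scalemxAl !mulmxA u_unit mul1mx.
by rewrite u_unit !mxE mulr1.
Qed.

(* Integrate d/ds tr (A - s u u^T)^m = - m u^T (A - s u u^T)^(m-1) u over
   [0, 1] and bound the integrand below by (d - s)^(m-1), d = u^T A u. *)
Lemma mxtrace_expr_rank1_update_le (m : nat) : odd m ->
  qform A u ^+ m - (qform A u - 1) ^+ m <=
  \tr (A ^+ m) - \tr ((A - u *m u^T) ^+ m).
Proof.
move=> m_odd; set d := qform A u.
have [k ->] : exists k, m = (2 * k).+1.
  by exists m./2; rewrite mul2n -[LHS]odd_double_half m_odd.
pose J := u *m u^T.
pose q : {poly R} := (d%:P - 'X) ^+ (2 * k).+1 - \tr (pencil A (- J) ^+ (2 * k).+1).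
have qE s : q.[s] = (d - s) ^+ (2 * k).+1 - \tr ((A - s *: J) ^+ (2 * k).+1).
  by rewrite /q !hornerE horner_mxtrace_pencil scalerN.
have q'_ge0 s : 0 <= q^`().[s].
  have As_sym : (A - s *: J)^T = A - s *: J.
    by rewrite linearB/= linearZ/= A_sym trmx_mul trmxK.
  have := expr_qform_le k As_sym u_unit; rewrite qform_rank1_update -/d.
  rewrite /q derivB hornerD hornerN deriv_mxtrace_pencil deriv_exp derivB.
  rewrite derivC derivX sub0r hornerMn hornerM horner_exp !hornerE scalerN.
  rewrite mulNmx linearN/= mxtrace_rank1M mulN1r !mulNrn opprK.
  by rewrite [X in _ -> 0 <= X]addrC -mulrnBl -subr_ge0; exact: mulrn_wge0.
have := @ler_hornerW _ 0 1 q (fun x _ => q'_ge0 x) 0 1.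
rewrite !in_itv/= !lexx ler01 => /(_ isT isT isT).
by rewrite !qE scale0r scale1r !subr0 => q0_le_q1; lra.
Qed.

End RankOneUpdate.

(** * Densities of odd cycles *)

Section ClosedWalks.
Variables (R : comNzRingType) (n : nat) (M : 'M[R]_n.+1).
Local Notation V := 'I_n.+1.

Definition walk_weight (a : V) (s : seq V) (b : V) : R :=
  \prod_(i < (size s).+1) M (nth b (a :: s) i) (nth b (a :: s) i.+1).

Lemma walk_weight_cons a c s b :
  walk_weight a (c :: s) b = M a c * walk_weight c s b.
Proof. by rewrite /walk_weight big_ord_recl. Qed.

Lemma sum_tuple_cons k (f : seq V -> R) :
  \sum_(s : k.+1.-tuple V) f s = \sum_c \sum_(s : k.-tuple V) f (c :: s).
Proof.
rewrite pair_bigA (reindex (fun p : V * k.-tuple V => [tuple of p.1 :: p.2])) //=.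
exists (fun s : k.+1.-tuple V => (thead s, [tuple of behead s])) => [[c s]|s] _.
  by congr (_, _); apply: val_inj.
by apply: val_inj; rewrite /= [in RHS](tuple_eta s).
Qed.

Lemma sum_walk_weight k a b :
  \sum_(s : k.-tuple V) walk_weight a s b = (M ^+ k.+1) a b.
Proof.
elim: k a => [|k IHk] a.
  rewrite (big_pred1 [tuple]) => [|s]; last by rewrite (tuple0 s) /= eqxx.
  by rewrite /walk_weight big_ord1 expr1.
rewrite (sum_tuple_cons _ (fun s => walk_weight a s b)) exprS mxE.
apply: eq_bigr => c _; rewrite -IHk mulr_sumr.
by apply: eq_bigr => s _; rewrite walk_weight_cons.
Qed.

Lemma sum_closed_walks k :
  \sum_(phi : {ffun 'I_k.+1 -> V}) \prod_i M (phi i) (phi (ordS i)) =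
  \tr (M ^+ k.+1).
Proof.
pose closed_walk (p : V * k.-tuple V) : {ffun 'I_k.+1 -> V} :=
  [ffun i : 'I_k.+1 => nth p.1 (p.1 :: p.2) i].
rewrite (reindex closed_walk) /=; last first.
  exists (fun phi : {ffun 'I_k.+1 -> V} =>
            (phi ord0, [tuple phi (lift ord0 j) | j < k])) => [[a s]|phi] _.
    rewrite ffunE /=; congr (_, _); apply: eq_from_tnth => j.
    by rewrite tnth_mktuple ffunE /= (tnth_nth a).
  apply/ffunP => i; rewrite ffunE /=; case: (unliftP ord0 i) => [j|] ->//=.
  by rewrite add0n (nth_map j) ?size_enum_ord// nth_ord_enum.
rewrite /mxtrace; under [RHS]eq_bigr do rewrite -sum_walk_weight.
rewrite pair_bigA; apply: eq_bigr => -[a s] _; rewrite /walk_weight size_tuple.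
apply: eq_bigr => i _; rewrite !ffunE /=; congr (M _ _).
have := ltn_ord i; rewrite ltnS leq_eqVlt => /orP[/eqP->|lt_ik].
  by rewrite modnn /= nth_default ?size_tuple.
by rewrite modn_small.
Qed.

End ClosedWalks.

Section CycleGraph.
Variable m : nat.
Hypothesis m_ge3 : (3 <= m)%N.

Lemma ordS_neq (i : 'I_m) : ordS i != i.
Proof.
rewrite -(inj_eq val_inj)/= -{2}(modn_small (ltn_ord i)) -addn1 -{2}[val i]addn0.
by rewrite eqn_modDl mod0n modn_small// (leq_trans _ m_ge3).
Qed.

Lemma ordSS_neq (i : 'I_m) : ordS (ordS i) != i.
Proof.
rewrite -(inj_eq val_inj)/= -{2}(modn_small (ltn_ord i)) -addn1 modnDml.
by rewrite addn1 -addn2 -{2}[val i]addn0 eqn_modDl mod0n modn_small.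
Qed.

Lemma cycle_adjE (i j : cycle_graph m) :
  adj i j = (j == ordS i) || (i == ordS j).
Proof.
rewrite /= /cycle_adj -!(inj_eq val_inj)/=; case: eqVneq => //= ij.
by have := ordS_neq j; rewrite -(inj_eq val_inj)/= ij eq_sym orbb => /negbTE.
Qed.

Lemma edges_cycle :
  edges (cycle_graph m) = [set [set i; ordS i] | i : cycle_graph m].
Proof.
apply/setP => e; apply/edgesP/imsetP => [[i [j [ij ->]]]|[i _ ->]]; last first.
  by exists i, (ordS i); rewrite cycle_adjE eqxx.
move: ij; rewrite cycle_adjE => /orP[/eqP->|/eqP->]; first by exists i.
by exists j; rewrite // setUC.
Qed.

Lemma cycle_edge_inj :
  injective (fun i : cycle_graph m => [set i; ordS i] : {set cycle_graph m}).
Proof.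
move=> i j /set2_eq[[]//|[-> jE]].
by have := ordSS_neq j; rewrite jE eqxx.
Qed.

Lemma nedges_cycle : nedges (cycle_graph m) = m.
Proof. by rewrite /nedges edges_cycle (card_imset _ cycle_edge_inj) card_ord. Qed.

Lemma edge_prod_cycle (R : comNzRingType) (U : Type) (w : U -> U -> R)
    (phi : cycle_graph m -> U) : commutative w ->
  edge_prod w phi = \prod_(i : 'I_m) w (phi i) (phi (ordS i)).
Proof.
move=> w_sym; rewrite /edge_prod edges_cycle big_imset/=; last first.
  by move=> i j _ _; exact: cycle_edge_inj.
by apply: eq_bigr => i _; rewrite edge_weightE// cycle_adjE eqxx.
Qed.

End CycleGraph.

Section WeightMatrix.
Variables (R : rcfType) (n : nat).
Implicit Types w : 'I_n.+1 -> 'I_n.+1 -> R.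

Definition weight_mx w : 'M[R]_n.+1 := \matrix_(i, j) (w i j / n.+1%:R).

Definition unit_const_mx : 'cV[R]_n.+1 := const_mx (Num.sqrt n.+1%:R^-1).

Lemma trmx_weight_mx w : commutative w -> (weight_mx w)^T = weight_mx w.
Proof. by move=> w_sym; apply/matrixP => i j; rewrite !mxE w_sym. Qed.

Lemma dens_cycle w m : (3 <= m)%N -> commutative w ->
  dens w (cycle_graph m) = \tr (weight_mx w ^+ m).
Proof.
move=> m_ge3 w_sym; have m_gt0 : (0 < m)%N by apply: leq_trans m_ge3.
rewrite -(prednK m_gt0) -sum_closed_walks prednK// /dens /mean mulr_suml.
apply: eq_bigr => phi _; rewrite edge_prod_cycle// card_ffun !card_ord natrX.
have -> : (n.+1%:R ^+ m)^-1 = \prod_(i < m) n.+1%:R^-1 :> R.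
  by rewrite prodr_const card_ord exprVn.
by rewrite -big_split; apply: eq_bigr => i _; rewrite mxE.
Qed.

Lemma sqr_sqrt_invn : Num.sqrt n.+1%:R^-1 * Num.sqrt n.+1%:R^-1 = n.+1%:R^-1 :> R.
Proof. by rewrite -expr2 sqr_sqrtr. Qed.

Lemma unit_const_mx_unit : unit_const_mx^T *m unit_const_mx = 1%:M.
Proof.
apply/matrixP => i j; rewrite !mxE !ord1 eqxx.
under eq_bigr do rewrite !mxE sqr_sqrt_invn.
by rewrite sumr_const card_ord -[_ *+ _]mulr_natr mulVf.
Qed.

Lemma unit_const_mxMtr :
  unit_const_mx *m unit_const_mx^T = const_mx n.+1%:R^-1.
Proof. by apply/matrixP => i j; rewrite !mxE big_ord1 !mxE sqr_sqrt_invn. Qed.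

Lemma qform_weight_mx w : qform (weight_mx w) unit_const_mx = edge_dens w.
Proof.
rewrite /qform mxE /edge_dens /mean -(pair_bigA _ w) exchange_big mulr_suml.
rewrite card_prod card_ord natrM invfM; apply: eq_bigr => j _.
rewrite !mxE !mulr_suml; apply: eq_bigr => i _.
by rewrite !mxE mulrAC sqr_sqrt_invn mulrCA mulrA.
Qed.

Lemma odd_cycle_goodman m w1 w2 : (3 <= m)%N -> odd m ->
  commutative w1 -> commutative w2 -> (forall x y, w1 x y + w2 x y = 1) ->
  edge_dens w1 ^+ m + edge_dens w2 ^+ m <=
  dens w1 (cycle_graph m) + dens w2 (cycle_graph m).
Proof.
move=> m_ge3 m_odd w1_sym w2_sym w12; rewrite !dens_cycle//.
have w2E x y : w2 x y = 1 - w1 x y by rewrite -(w12 x y) addrC addKr.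
set A := weight_mx w1; set d := edge_dens w1.
have weight2 : weight_mx w2 = - (A - unit_const_mx *m unit_const_mx^T).
  apply/matrixP => i j.
  by rewrite unit_const_mxMtr !mxE w2E mulrBl mul1r opprB.
have dens2 : edge_dens w2 = - (d - 1).
  by rewrite opprB -(edge_dens_complement _ w12) ?card_ord// addrC addKr.
have oppX (S : nzRingType) (x : S) : (- x) ^+ m = - x ^+ m.
  by rewrite exprNn -signr_odd m_odd mulN1r.
have := mxtrace_expr_rank1_update_le (trmx_weight_mx w1_sym) unit_const_mx_unit m_odd.
by rewrite qform_weight_mx weight2 dens2 !oppX linearN.
Qed.

End WeightMatrix.

(** * Entropy *)

Section Law.
Variable R : realType.
Implicit Types S T U W : finType.

Definition is_law T (nu : T -> R) : Prop :=
  (forall x, 0 <= nu x) /\ \sum_x nu x = 1.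

Definition law S T (mu : S -> R) (X : S -> T) (x : T) : R :=
  \sum_(s | X s == x) mu s.

Definition entropy T (nu : T -> R) : R := - \sum_x nu x * ln (nu x).

Lemma exists_law_neq0 T (nu : T -> R) : is_law nu -> exists x, nu x != 0.
Proof.
case=> _ nu_sum1; apply/existsP; apply: contraT => /existsPn nu0.
have := oner_neq0 R; rewrite -nu_sum1 big1 ?eqxx// => x _.
by apply/eqP; have := nu0 x; rewrite negbK.
Qed.

Section Image.
Variables (S T : finType) (mu : S -> R) (X : S -> T).

Lemma sum_lawM (f : T -> R) : \sum_x law mu X x * f x = \sum_s mu s * f (X s).
Proof.
under eq_bigr do rewrite mulr_suml.
rewrite (exchange_big_dep xpredT)//=; apply: eq_bigr => s _.
by rewrite (big_pred1 (X s))// => x; rewrite /= eq_sym.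
Qed.

Lemma sum_law : \sum_x law mu X x = \sum_s mu s.
Proof. by rewrite [RHS](partition_big X xpredT). Qed.

Lemma law_comp U (Y : T -> U) : law (law mu X) Y = law mu (Y \o X).
Proof.
apply/funext => y; rewrite /law [RHS](partition_big X (fun x => Y x == y))//=.
apply: eq_bigr => x /eqP <-; apply: eq_bigl => s.
by case: (eqVneq (X s) x) => [->|]; rewrite ?eqxx ?andbF.
Qed.

Lemma law_neq0 x : law mu X x != 0 -> exists2 s, mu s != 0 & X s = x.
Proof.
case: (pickP [pred s | (mu s != 0) && (X s == x)]) => [s /andP[mus /eqP Xs]|none].
  by exists s.
rewrite /law big1 ?eqxx// => s Xs.
by apply/eqP; have := none s; rewrite /= Xs andbT => /negbFE.
Qed.

Lemma entropy_law : entropy (law mu X) = - \sum_s mu s * ln (law mu X (X s)).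
Proof. by rewrite /entropy (sum_lawM (fun x => ln (law mu X x))). Qed.

Lemma entropy_law_inj :
  {in [pred s | mu s != 0] &, injective X} -> entropy (law mu X) = entropy mu.
Proof.
move=> X_inj; rewrite entropy_law; congr (- _); apply: eq_bigr => s _.
have [->|mus] := eqVneq (mu s) 0; first by rewrite !mul0r.
congr (_ * ln _); rewrite /law (bigD1 s)//= big1 ?addr0// => s' /andP[/eqP Xs' s'Ns].
by apply/eqP; apply: contraNT s'Ns => mus'; apply/eqP/X_inj.
Qed.

Hypothesis mu_law : is_law mu.

Lemma law_ge0 x : 0 <= law mu X x.
Proof. by case: mu_law => mu_ge0 _; rewrite sumr_ge0. Qed.

Lemma law_is_law : is_law (law mu X).
Proof. by split; [exact: law_ge0|rewrite sum_law; case: mu_law]. Qed.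

Lemma law_gt0 s : mu s != 0 -> 0 < law mu X (X s).
Proof.
case: mu_law => mu_ge0 _ mus; rewrite /law (bigD1 s)//=.
by rewrite ltr_pwDl ?sumr_ge0// lt0r mus mu_ge0.
Qed.

End Image.

Lemma eq_entropy_law S T U (mu : S -> R) (X : S -> T) (Y : S -> U) :
  (forall s s', (X s == X s') = (Y s == Y s')) ->
  entropy (law mu X) = entropy (law mu Y).
Proof.
move=> eq_ker; rewrite !entropy_law; congr (- _); apply: eq_bigr => s _.
by congr (_ * ln _); apply: eq_bigl => s'; exact: eq_ker.
Qed.

Lemma law_bij S T (mu : S -> R) (X : S -> T) (g : S -> S) :
  bijective g -> mu \o g =1 mu -> law mu (X \o g) = law mu X.
Proof.
move=> g_bij mu_g; apply/funext => x.
rewrite /law [RHS](reindex g) /=; last exact: onW_bij.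
by apply: eq_bigr => s _; exact: esym (mu_g s).
Qed.

Lemma law_fst S T (K : S * T -> R) x : law K fst x = \sum_y K (x, y).
Proof.
rewrite /law (reindex_onto (pair x) snd) /= => [|[x' y] /eqP/= ->//].
by apply: eq_bigl => y; rewrite !eqxx.
Qed.

Lemma law_snd S T (K : S * T -> R) y : law K snd y = \sum_x K (x, y).
Proof.
rewrite /law (reindex_onto (pair^~ y) fst) /= => [|[x y'] /eqP/= ->//].
by apply: eq_bigl => x; rewrite !eqxx.
Qed.

Lemma ln_prod (I : finType) (P : pred I) (f : I -> R) :
  (forall i, P i -> 0 < f i) -> ln (\prod_(i | P i) f i) = \sum_(i | P i) ln (f i).
Proof.
move=> f_gt0.
suff [] : 0 < \prod_(i | P i) f i /\
    ln (\prod_(i | P i) f i) = \sum_(i | P i) ln (f i) by [].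
elim/big_rec2: _ => [|i x y Pi [y_gt0 <-]]; first by rewrite ln1.
by rewrite lnM ?posrE ?f_gt0// mulr_gt0 ?f_gt0.
Qed.

Lemma gibbs_le T (nu a : T -> R) : is_law nu -> (forall x, 0 <= a x) ->
  (forall x, nu x != 0 -> 0 < a x) ->
  entropy nu + \sum_x nu x * ln (a x) <= ln (\sum_x a x).
Proof.
move=> nu_law a_ge0 a_gt0; have [nu_ge0 nu_sum1] := nu_law.
set Z := \sum_x a x.
have Z_gt0 : 0 < Z.
  have [x nux] := exists_law_neq0 nu_law.
  by rewrite /Z (bigD1 x)//= ltr_pwDl ?a_gt0 ?sumr_ge0.
rewrite addrC -subr_le0 -[ln Z]mul1r -nu_sum1 mulr_suml -!sumrB.
apply: (@le_trans _ _ (\sum_x (a x / Z - nu x))); last first.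
  by rewrite sumrB -mulr_suml divff ?gt_eqF// nu_sum1 subrr.
apply: ler_sum => x _; have [->|nux] := eqVneq (nu x) 0.
  by rewrite !mul0r !subr0 divr_ge0// ltW.
have nu_gt0 : 0 < nu x by rewrite lt0r nux nu_ge0.
have -> : a x / Z - nu x = nu x * (a x / (Z * nu x) - 1).
  by field; rewrite nux gt_eqF.
rewrite -!mulrBr ler_wpM2l//.
have -> : ln (a x) - ln (nu x) - ln Z = ln (1 + (a x / (Z * nu x) - 1)).
  rewrite [1 + _]addrC subrK ln_div ?posrE ?mulr_gt0 ?a_gt0// lnM ?posrE//.
  by rewrite opprD addrA addrAC.
by rewrite le_ln1Dx// ltrBrDr addNr divr_gt0 ?a_gt0 ?mulr_gt0.
Qed.

Lemma gibbs_eq T (a : T -> R) (Z := \sum_x a x) :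
  (forall x, 0 <= a x) -> 0 < Z ->
  entropy (fun x => a x / Z) + \sum_x a x / Z * ln (a x) = ln Z.
Proof.
move=> a_ge0 Z_gt0; have Z_neq0 : Z != 0 by rewrite gt_eqF.
rewrite /entropy addrC -sumrB -[RHS]mul1r -(divff Z_neq0) !mulr_suml.
apply: eq_bigr => x _; rewrite -mulrBr.
have [->|ax] := eqVneq (a x) 0; first by rewrite !mul0r.
by rewrite ln_div ?posrE// ?lt0r ?ax ?a_ge0// opprB addrC subrK.
Qed.

(* Gibbs' inequality for the law of (X, Y, Z), against the law under which X and
   Z are independent given Y. *)
Lemma entropy_submodular S T U W (mu : S -> R) (X : S -> T) (Y : S -> U) (Z : S -> W) :
  is_law mu ->
  entropy (law mu (fun s => (X s, Y s, Z s))) + entropy (law mu Y) <=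
  entropy (law mu (fun s => (X s, Y s))) + entropy (law mu (fun s => (Y s, Z s))).
Proof.
move=> mu_law; have [_ mu_sum1] := mu_law.
pose pXY := law mu (fun s => (X s, Y s)); pose pYZ := law mu (fun s => (Y s, Z s)).
pose a (t : T * U * W) := pXY t.1 * pYZ (t.1.2, t.2) / law mu Y t.1.2.
have a_ge0 t : 0 <= a t by rewrite divr_ge0 ?mulr_ge0 ?law_ge0.
have pXY_gt0 s : mu s != 0 -> 0 < pXY (X s, Y s) by exact: law_gt0.
have pYZ_gt0 s : mu s != 0 -> 0 < pYZ (Y s, Z s) by exact: law_gt0.
have pY_gt0 s : mu s != 0 -> 0 < law mu Y (Y s) by exact: law_gt0.
have sum_a : \sum_t a t = 1.
  rewrite -(pair_bigA _ (fun p z => a (p, z)))/=.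
  rewrite -(pair_bigA _ (fun x y => \sum_z a (x, y, z)))/= exchange_big.
  rewrite -mu_sum1 -(sum_law mu Y); apply: eq_bigr => y _; rewrite /a/=.
  under eq_bigr do rewrite -mulr_suml -mulr_sumr -law_fst law_comp.
  rewrite -!mulr_suml -law_snd law_comp.
  by have [->|pY_neq0] := eqVneq (law mu Y y) 0; rewrite ?mul0r ?mulfK.
have := gibbs_le (law_is_law (fun s => (X s, Y s, Z s)) mu_law) a_ge0.
rewrite sum_a ln1 (sum_lawM _ _ (fun t => ln (a t))).
rewrite (eq_bigr (fun s => mu s * ln (pXY (X s, Y s)) + mu s * ln (pYZ (Y s, Z s)) -
  mu s * ln (law mu Y (Y s)))) => [|s _]; last first.
  have [->|mus] := eqVneq (mu s) 0; first by rewrite !mul0r addr0 subr0.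
  by rewrite -mulrDr -mulrBr ln_div ?lnM ?posrE ?mulr_gt0 ?pXY_gt0 ?pYZ_gt0 ?pY_gt0.
rewrite sumrB big_split/= [entropy (law mu Y)]entropy_law.
rewrite (entropy_law _ (fun s => (X s, Y s))) (entropy_law _ (fun s => (Y s, Z s))).
move=> gibbs; suff a_gt0 t : law mu (fun s => (X s, Y s, Z s)) t != 0 -> 0 < a t.
  by have := gibbs a_gt0; lra.
by case/law_neq0=> s mus <-; rewrite divr_gt0 ?mulr_gt0 ?pXY_gt0 ?pYZ_gt0 ?pY_gt0.
Qed.

End Law.

Section Coupling.
Variables (R : realType) (S T E : finType) (nu : S -> R) (mu : T -> R).
Variables (X : S -> E) (Y : T -> E).

(* The law of a pair that is independent given the common value of X and Y. *)
Definition coupling (p : S * T) : R :=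
  if X p.1 == Y p.2 then nu p.1 * mu p.2 / law mu Y (Y p.2) else 0.

Hypothesis nu_law : is_law nu.
Hypothesis mu_law : is_law mu.
Hypothesis eq_law : law nu X = law mu Y.

Lemma coupling_neq0 p :
  coupling p != 0 -> [/\ nu p.1 != 0, mu p.2 != 0 & X p.1 = Y p.2].
Proof.
rewrite /coupling; case: ifP => [/eqP XY|_]; last by rewrite eqxx.
by rewrite !mulf_eq0 !negb_or => /andP[/andP[nu_neq0 mu_neq0] _].
Qed.

Lemma coupling_ge0 p : 0 <= coupling p.
Proof.
have [nu_ge0 _] := nu_law; have [mu_ge0 _] := mu_law.
by rewrite /coupling; case: eqP => // _; rewrite divr_ge0 ?mulr_ge0 ?law_ge0.
Qed.

Lemma law_coupling_fst : law coupling fst = nu.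
Proof.
apply/funext => s; rewrite law_fst /coupling/= -big_mkcond/=.
transitivity (\sum_(t | Y t == X s) nu s * mu t / law mu Y (X s)).
  by apply: eq_big => [t|t /eqP->]; rewrite // eq_sym.
rewrite -mulr_suml -mulr_sumr -/(law mu Y (X s)) -eq_law.
have [->|nus] := eqVneq (nu s) 0; first by rewrite !mul0r.
by rewrite mulfK// gt_eqF ?law_gt0.
Qed.

Lemma law_coupling_snd : law coupling snd = mu.
Proof.
apply/funext => t; rewrite law_snd /coupling/= -big_mkcond/= -!mulr_suml.
rewrite -/(law nu X (Y t)) eq_law.
have [->|mut] := eqVneq (mu t) 0; first by rewrite mulr0 mul0r.
by rewrite mulrAC mulfV ?mul1r// gt_eqF ?law_gt0.
Qed.

Lemma coupling_is_law : is_law coupling.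
Proof.
have [_ nu_sum1] := nu_law; split; first exact: coupling_ge0.
by rewrite -nu_sum1 -(sum_law _ fst) law_coupling_fst.
Qed.

Lemma entropy_coupling :
  entropy coupling = entropy nu + entropy mu - entropy (law mu Y).
Proof.
have [nu_ge0 _] := nu_law; have [mu_ge0 _] := mu_law.
transitivity
  (- \sum_p coupling p * (ln (nu p.1) + ln (mu p.2) - ln (law mu Y (Y p.2)))).
  congr (- _); apply: eq_bigr => p _.
  have [->|Kp] := eqVneq (coupling p) 0; first by rewrite !mul0r.
  have [nup mup XY] := coupling_neq0 Kp; congr (_ * _).
  have nu_gt0 : 0 < nu p.1 by rewrite lt0r nup nu_ge0.
  have mu_gt0 : 0 < mu p.2 by rewrite lt0r mup mu_ge0.
  by rewrite /coupling XY eqxx ln_div ?lnM ?posrE ?mulr_gt0 ?law_gt0.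
under eq_bigr do rewrite mulrBr mulrDr.
rewrite sumrB big_split/= -(sum_lawM _ fst (fun s => ln (nu s))).
rewrite -(sum_lawM _ snd (fun t => ln (mu t))).
rewrite -(sum_lawM _ snd (fun t => ln (law mu Y (Y t)))).
by rewrite law_coupling_fst law_coupling_snd entropy_law /entropy; ring.
Qed.

End Coupling.

Section SetEntropy.
Variables (R : realType) (V F : finType).
Implicit Types (A B : {set F}) (phi psi : {ffun F -> V}).

Definition prestrict A (g : F -> option V) : {ffun F -> option V} :=
  [ffun u => if u \in A then g u else None].

Definition restriction A phi : {ffun F -> option V} :=
  prestrict A (fun u => Some (phi u)).

Lemma restrictionP A phi psi :
  reflect {in A, phi =1 psi} (restriction A phi == restriction A psi).
Proof.
apply: (iffP eqP) => [/ffunP eqA u uA|eqA].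
  by have := eqA u; rewrite !ffunE uA => -[].
by apply/ffunP => u; rewrite !ffunE; case: ifP => // /eqA->.
Qed.

Lemma restriction_in A phi u : u \in A -> restriction A phi u = Some (phi u).
Proof. by rewrite ffunE => ->. Qed.

Lemma prestrict_restriction A B phi :
  A \subset B -> prestrict A (restriction B phi) = restriction A phi.
Proof.
move=> /subsetP AB; apply/ffunP => u; rewrite !ffunE.
by case: ifP => // /AB->.
Qed.

Lemma restrictionU_eq A B phi psi :
  (restriction (A :|: B) phi == restriction (A :|: B) psi) =
  (restriction A phi == restriction A psi) && (restriction B phi == restriction B psi).
Proof.
apply/restrictionP/andP => [eqAB|[/restrictionP eqA /restrictionP eqB] u].
  by split; apply/restrictionP => u uS; apply: eqAB; rewrite inE uS ?orbT.
by rewrite inE => /orP[/eqA|/eqB].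
Qed.

Definition set_entropy (mu : {ffun F -> V} -> R) A : R :=
  entropy (law mu (restriction A)).

Variable mu : {ffun F -> V} -> R.

Lemma set_entropyT : set_entropy mu [set: F] = entropy mu.
Proof.
apply: entropy_law_inj => phi psi _ _ /eqP/restrictionP eqT.
by apply/ffunP => u; rewrite eqT.
Qed.

Lemma set_entropy_imset (f : {perm F}) A :
  (forall phi, mu (precomp f phi) = mu phi) ->
  set_entropy mu (f @: A) = set_entropy mu A.
Proof.
move=> mu_f; rewrite /set_entropy.
rewrite -(law_bij (restriction A) (precomp_perm_bij V f) mu_f).
apply: eq_entropy_law => phi psi; apply/restrictionP/restrictionP => [eqfA u uA|eqA].
  by rewrite !ffunE eqfA ?imset_f.
by move=> _ /imsetP[u uA ->]; have := eqA u uA; rewrite !ffunE.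
Qed.

Hypothesis mu_law : is_law mu.

Lemma set_entropy0 : set_entropy mu set0 = 0.
Proof.
rewrite /set_entropy entropy_law big1 ?oppr0// => phi _.
rewrite /law (eq_bigl xpredT) => [|psi].
  by case: mu_law => _ ->; rewrite ln1 mulr0.
by apply/restrictionP => u; rewrite inE.
Qed.

Lemma set_entropy_submodular A B C :
  set_entropy mu (A :|: B :|: C) + set_entropy mu B <=
  set_entropy mu (A :|: B) + set_entropy mu (B :|: C).
Proof.
have pairE A' B' :
    entropy (law mu (fun phi => (restriction A' phi, restriction B' phi))) =
    set_entropy mu (A' :|: B').
  by apply: eq_entropy_law => phi psi; rewrite restrictionU_eq.
have tripleE : entropy (law mu (fun phi =>
    (restriction A phi, restriction B phi, restriction C phi))) =
    set_entropy mu (A :|: B :|: C).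
  by apply: eq_entropy_law => phi psi; rewrite !restrictionU_eq.
by rewrite -tripleE -!pairE; exact: entropy_submodular.
Qed.

End SetEntropy.

(** * Random gluing along a tree *)

Section TreeInduction.
Variable T : sgraph.
Implicit Types (s t x y : T) (A : {set T}).

Definition inner_adj A : rel T := fun x y => [&& adj x y, x \in A & y \in A].

Definition connected_in A : Prop := {in A &, forall x y, connect (inner_adj A) x y}.

Definition attaches A s t : Prop :=
  [/\ s \in A, t \notin A, adj s t & forall s', s' \in A -> adj s' t -> s' = s].

Lemma inner_adj_sym A : connect_sym (inner_adj A).
Proof.
by apply: sym_connect_sym => x y; rewrite /inner_adj adj_sym [X in _ && X]andbC.
Qed.

Lemma exists_boundary_edge A : (forall x y, connect (@adj T) x y) ->
  A != set0 -> A != [set: T] -> exists s t, [/\ s \in A, t \notin A & adj s t].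
Proof.
move=> T_conn /set0Pn[x xA]; apply: contraNP => no_edge.
rewrite -subTset; apply/subsetP => y _.
have A_closed : fingraph.closed (@adj T) (mem A).
  apply: (intro_closed (sym_connect_sym (@adj_sym T))) => s t st sA.
  by apply: contraT => tA; case: no_edge; exists s, t.
by have <- : (x \in A) = (y \in A) := closed_connect A_closed (T_conn x y).
Qed.

Lemma connected_inU1 A s t :
  connected_in A -> s \in A -> adj s t -> connected_in (t |: A).
Proof.
move=> A_conn sA st.
have inner_sub : subrel (inner_adj A) (connect (inner_adj (t |: A))).
  move=> x y /and3P[xy xA yA]; apply: connect1.
  by rewrite /inner_adj xy !inE xA yA !orbT.
have from_s x : x \in t |: A -> connect (inner_adj (t |: A)) s x.
  case/setU1P=> [->|xA]; last exact: connect_sub inner_sub _ _ (A_conn s x sA xA).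
  by apply: connect1; rewrite /inner_adj st !inE sA eqxx orbT.
move=> x y /from_s sx /from_s; apply: connect_trans.
by rewrite inner_adj_sym.
Qed.

(* A path in A between two neighbours of t would close up into a cycle. *)
Lemma acyclic_attaches A s t :
  (forall c : seq T, ucycle (@adj T) c -> (size c <= 2)%N) ->
  connected_in A -> s \in A -> t \notin A -> adj s t -> attaches A s t.
Proof.
move=> T_acyc A_conn sA tNA st; split=> // s' s'A s't.
have /connectP[p s_path s'E] := A_conn s s' sA s'A.
case: (shortenP s_path) s'E => {s_path}p s_path s_uniq _ s'E.
have tNp : t \notin p.
  apply: contra tNA => tp; move: s_path; rewrite -[p]cats0.
  case/splitPr: tp => p1 p2; rewrite cats0 cat_path => /andP[_ /= /andP[+ _]].
  by case/and3P.
have : ucycle (@adj T) (t :: s :: p).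
  apply/andP; split.
    rewrite /= adj_sym st rcons_path -s'E s't andbT /=.
    by apply: sub_path s_path => x y /and3P[].
  by rewrite cons_uniq s_uniq andbT inE negb_or tNp andbT (contraTneq _ sA)// => <-.
by move/T_acyc => /=; rewrite !ltnS leqn0 => /nilP pE; rewrite s'E pE.
Qed.

Lemma tree_ind (P : {set T} -> Prop) : is_tree T ->
  (forall s, P [set s]) ->
  (forall A s t, P A -> attaches A s t -> P (t |: A)) ->
  P [set: T].
Proof.
move=> [/card_gt0P[s _] T_conn T_acyc] P_set1 P_setU1.
suff grow k A : (#|~: A| <= k)%N -> A != set0 -> connected_in A -> P A -> P [set: T].
  apply: (grow _ [set s] (leqnn _)) => //; first by rewrite -card_gt0 cards1.
  by move=> x y /set1P-> /set1P->.
elim: k A => [|k IHk] A leAk A_neq0 A_conn PA.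
  by move: leAk; rewrite leqn0 cards_eq0 -setCT (inj_eq (@setC_inj _)) => /eqP <-.
have [<-//|ANT] := eqVneq A [set: T].
have [x [y [xA yNA xy]]] := exists_boundary_edge T_conn A_neq0 ANT.
apply: (IHk (y |: A)).
- by rewrite -ltnS (leq_trans _ leAk)// proper_card// properC properUr// sub1set.
- by apply/set0Pn; exists y; rewrite setU11.
- exact: connected_inU1 xy.
- exact: P_setU1 (acyclic_attaches T_acyc A_conn xA yNA xy).
Qed.

Lemma big_edges_set1 (M : Type) (idx : M) (op : Monoid.law idx) s (f : {set T} -> M) :
  \big[op/idx]_(e in edges T | e \subset [set s]) f e = idx.
Proof. by rewrite big_pred0// => e; have [/edge_sub1->|] := boolP (e \in edges T). Qed.

Lemma big_edges_setU1 (M : Type) (idx : M) (op : Monoid.com_law idx) A s t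
    (f : {set T} -> M) : attaches A s t ->
  \big[op/idx]_(e in edges T | e \subset t |: A) f e =
  op (f [set s; t]) (\big[op/idx]_(e in edges T | e \subset A) f e).
Proof.
move=> [sA tNA st s_uniq]; rewrite (bigD1 [set s; t]) /=; last first.
  by rewrite mem_edges st subUset !sub1set !inE sA eqxx orbT.
congr (op _ _); apply: eq_bigl => e.
case: (boolP (e \in edges T)) => //= /edgesP[x [y [xy ->]]].
rewrite !subUset !sub1set.
have inA z z' : adj z z' -> z \in t |: A -> z' \in t |: A ->
    [set z; z'] != [set s; t] -> z \in A.
  move=> zz' ztA z'tA; case/setU1P: ztA zz' => [->|//].
  case/setU1P: z'tA => [->|z'A]; first by rewrite adj_irrefl.
  by rewrite adj_sym => /(s_uniq _ z'A)->; rewrite setUC eqxx.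
apply/idP/idP => [/andP[/andP[xtA ytA] xyNst]|/andP[xA yA]].
  by rewrite (inA x y)// (inA y x)// 1?adj_sym// setUC.
rewrite !in_setU1 xA yA !orbT; apply: contraNneq tNA => xyE.
have : t \in [set x; y] by rewrite xyE set22.
by case/set2P=> ->.
Qed.

End TreeInduction.

Section TreeLaw.
Variables (R : realType) (V : finType) (F : sgraph) (P : template F).
Variable mu : {ffun F -> V} -> R.
Local Notation T := (tree P).
Local Notation row := {ffun F -> option V}.
Implicit Types (A : {set T}) (G : {ffun T -> row}) (s t : T) (r : row).

Definition graft t G r : {ffun T -> row} := [ffun s => if s == t then r else G s].

Lemma graft_same t G r : graft t G r t = r.
Proof. by rewrite ffunE eqxx. Qed.

Lemma graft_neq t G r s : s != t -> graft t G r s = G s.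
Proof. by rewrite ffunE => /negbTE->. Qed.

Definition consistent_on A G : Prop :=
  (forall s, s \notin A -> G s = [ffun=> None]) /\
  (forall s t, s \in A -> t \in A -> adj s t ->
     prestrict (psiE P [set s; t]) (G s) = prestrict (psiE P [set s; t]) (G t)).

Lemma graft_consistent A s t G r : attaches A s t -> consistent_on A G ->
  prestrict (psiE P [set s; t]) (G s) = prestrict (psiE P [set s; t]) r ->
  consistent_on (t |: A) (graft t G r).
Proof.
move=> [sA tNA st s_uniq] [G_out G_in] eq_st.
have neqt s' : s' \in A -> s' != t by apply: contraTneq => ->.
split=> [s'|s1 s2].
  by rewrite !inE negb_or => /andP[s'Nt s'NA]; rewrite graft_neq// G_out.
move=> /setU1P[->|s1A] /setU1P[->|s2A]; rewrite ?adj_irrefl//.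
- rewrite adj_sym => /(s_uniq _ s2A)->.
  by rewrite graft_same graft_neq ?neqt// setUC.
- by move=> /(s_uniq _ s1A)->; rewrite graft_same graft_neq ?neqt.
- by rewrite !graft_neq ?neqt//; exact: G_in.
Qed.

Lemma graft_inj A t G G' r r' : t \notin A ->
  consistent_on A G -> consistent_on A G' ->
  graft t G r = graft t G' r' -> (G, r) = (G', r').
Proof.
move=> tNA [G_out _] [G'_out _] /ffunP eq_graft.
have := eq_graft t; rewrite !graft_same => ->.
congr (_, _); apply/ffunP => s; have [->|sNt] := eqVneq s t.
  by rewrite G_out// G'_out.
by have := eq_graft s; rewrite !graft_neq.
Qed.

(* The law nu of a random gluing, along the part A of the tree, of copies of a
   mu-random map that are independent given their values on the sets psi(st). *)
Definition tree_law A (nu : {ffun T -> row} -> R) : Prop :=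
  [/\ is_law nu,
      forall s, s \in A -> law nu (fun G => G s) = law mu (restriction (psiV P s)),
      forall G, nu G != 0 -> consistent_on A G &
      entropy nu = \sum_(s in A) set_entropy mu (psiV P s) -
                   \sum_(e in edges T | e \subset A) set_entropy mu (psiE P e)].

Lemma psiE_sub s t : adj s t ->
  psiE P [set s; t] \subset psiV P s /\ psiE P [set s; t] \subset psiV P t.
Proof. by move/psi_sub; rewrite subsetI => /andP[]. Qed.

Hypothesis mu_law : is_law mu.

Lemma exists_tree_law1 s : exists nu, tree_law [set s] nu.
Proof.
pose g phi := graft s [ffun=> [ffun=> None]] (restriction (psiV P s) phi).
exists (law mu g); split.
- exact: law_is_law.
- move=> s' /set1P->; rewrite law_comp; congr (law mu _).
  by apply/funext => phi; exact: graft_same.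
- move=> G /law_neq0[phi _ <-]; split=> [s'|s1 s2].
    by rewrite inE => s's; rewrite graft_neq// ffunE.
  by move=> /set1P-> /set1P->; rewrite adj_irrefl.
- rewrite big_set1 big_edges_set1 subr0.
  apply: eq_entropy_law => phi psi; apply/eqP/eqP => [|eq_rows].
    by move/(congr1 (fun G : {ffun T -> row} => G s)); rewrite !graft_same.
  by rewrite /g eq_rows.
Qed.

Lemma law_prestrict s (B : {set F}) : B \subset psiV P s ->
  law (law mu (restriction (psiV P s))) (prestrict B) = law mu (restriction B).
Proof.
move=> BP; rewrite law_comp; congr (law mu _); apply/funext => phi.
exact: prestrict_restriction.
Qed.

(* The new row is coupled with the one at s over their common part on psi(st). *)
Lemma exists_tree_lawU1 A s t nu :
  tree_law A nu -> attaches A s t -> exists nu', tree_law (t |: A) nu'.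
Proof.
move=> [nu_law nu_marg nu_cons nu_ent] attach; have [sA tNA st _] := attach.
set B := psiE P [set s; t]; have [Bs Bt] : B \subset psiV P s /\ B \subset psiV P t.
  exact: psiE_sub.
pose mu_t := law mu (restriction (psiV P t)).
pose X G := prestrict B (G s); pose K := coupling nu mu_t X (prestrict B).
have mu_t_law : is_law mu_t by exact: law_is_law.
have eq_marg : law nu X = law mu_t (prestrict B).
  transitivity (law (law nu (fun G => G s)) (prestrict B)); first by rewrite law_comp.
  by rewrite nu_marg// !law_prestrict.
have K_law : is_law K by exact: coupling_is_law.
have fstK := law_coupling_fst nu_law eq_marg.
have sndK := law_coupling_snd mu_t_law eq_marg.
have neqt s' : s' \in A -> s' != t by apply: contraTneq => ->.
exists (law K (fun q => graft t q.1 q.2)); split.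
- exact: law_is_law.
- move=> s' /setU1P[->|s'A]; rewrite law_comp.
    by rewrite -[RHS]sndK; congr law; apply/funext => q; exact: graft_same.
  rewrite -nu_marg// -fstK law_comp; congr law; apply/funext => q /=.
  by rewrite graft_neq ?neqt.
- move=> _ /law_neq0[[G r] /coupling_neq0[/= nuG _ Xr] <-].
  exact: graft_consistent attach (nu_cons G nuG) Xr.
- rewrite entropy_law_inj => [|[G r] [G' r']].
    rewrite entropy_coupling// nu_ent law_prestrict//.
    rewrite (big_setU1 _ tNA) (big_edges_setU1 _ _ attach) /=.
    rewrite /set_entropy -/B -/mu_t; ring.
  rewrite !inE => /coupling_neq0[/= nuG _ _] /coupling_neq0[/= nuG' _ _].
  exact: graft_inj tNA (nu_cons G nuG) (nu_cons G' nuG').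
Qed.

Lemma exists_tree_law : exists nu, tree_law [set: T] nu.
Proof.
apply: (tree_ind (treeP P) (P := fun A => exists nu, tree_law A nu)).
  exact: exists_tree_law1.
by move=> A s t [nu nuA]; exact: exists_tree_lawU1 nuA.
Qed.

End TreeLaw.

Section CardGlued.
Variables (F : sgraph) (P : template F).
Local Notation T := (tree P).
Implicit Types (s t : T) (A : {set T}) (p q : T * F).

Definition glued_class p : {set T * F} :=
  [set q in copies P | connect (@identified F P) p q].

Lemma identified_sym : connect_sym (@identified F P).
Proof.
apply: sym_connect_sym => p q; rewrite /identified adj_sym eq_sym setUC.
by case: (eqVneq p.2) => // ->.
Qed.

Lemma eq_glued_class p q : identified p q -> glued_class p = glued_class q.
Proof.
move=> pq; apply/setP => r; rewrite !inE.
by rewrite (same_connect1 identified_sym pq).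
Qed.

Definition copies_over A : {set T * F} := [set p in copies P | p.1 \in A].

Lemma copies_overU1 A t :
  copies_over (t |: A) = copies_over A :|: [set (t, v) | v in psiV P t].
Proof.
apply/setP => -[s v]; rewrite !inE/=; apply/andP/orP => [[vs /orP[/eqP st|sA]]|].
- by right; apply/imsetP; exists v; rewrite ?st // -st.
- by left; rewrite vs.
- case=> [/andP[vs sA]|/imsetP[u ut [-> ->]]]; first by rewrite sA orbT.
  by rewrite eqxx.
Qed.

Lemma card_glued_classes_over A s t : attaches A s t ->
  (#|glued_class @: copies_over (t |: A)| + #|psiE P [set s; t]| <=
   #|glued_class @: copies_over A| + #|psiV P t|)%N.
Proof.
move=> [sA tNA st _]; have [es et] := psiE_sub st.
set e := psiE P [set s; t] in es et *.
have sub : glued_class @: copies_over (t |: A) \subset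
    glued_class @: copies_over A :|: [set glued_class (t, v) | v in psiV P t :\: e].
  rewrite copies_overU1 imsetU subUset subsetUl/= -imset_comp.
  apply/subsetP => _ /imsetP[v vt ->]; rewrite inE.
  have [ve|ve] := boolP (v \in e); last by rewrite orbC imset_f// inE ve.
  rewrite /= -(@eq_glued_class (s, v)) ?imset_f ?inE ?(subsetP es)//.
  by rewrite /identified /= st eqxx.
have le_sum := leq_trans (subset_leq_card sub) (leq_card_setU _ _).1.
apply: leq_trans (leq_add le_sum (leqnn _)) _.
rewrite -addnA leq_add2l -(cardsID e (psiV P t)) (setIidPr et) addnC leq_add2l.
exact: leq_imset_card.
Qed.

Lemma card_glued_classes1 s :
  (#|glued_class @: copies_over [set s]| <= #|psiV P s|)%N.
Proof.
apply: leq_trans (leq_imset_card _ _) _.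
rewrite -[[set s]]setU0 copies_overU1 (_ : copies_over set0 = set0); last first.
  by apply/setP => p; rewrite !inE andbF.
by rewrite set0U leq_imset_card.
Qed.

Lemma card_gluedE : #|glued P| = #|glued_class @: copies_over [set: T]|.
Proof.
rewrite card_sig (_ : copies_over setT = copies P); first by apply: eq_card.
by apply/setP => p; rewrite !inE andbT.
Qed.

Lemma card_glued :
  (#|glued P| + \sum_(e in edges T) #|psiE P e| <= \sum_s #|psiV P s|)%N.
Proof.
pose bound A := (#|glued_class @: copies_over A| +
  \sum_(e in edges T | e \subset A) #|psiE P e| <= \sum_(s in A) #|psiV P s|)%N.
suff : bound [set: T].
  rewrite /bound -card_gluedE (eq_bigl (mem (edges T))) => [|e]; last first.
    by rewrite subsetT andbT.
  by rewrite [X in (_ <= X)%N](eq_bigl xpredT) => // s; rewrite inE.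
apply: (tree_ind (P := bound) (treeP P)) => [s|A s t boundA attach]; rewrite /bound.
- by rewrite big_set1 big_edges_set1 addn0 card_glued_classes1.
- have [_ tNA _ _] := attach.
  rewrite (big_setU1 _ tNA) (big_edges_setU1 _ _ attach) /= addnA.
  apply: leq_trans (leq_add (card_glued_classes_over attach) (leqnn _)) _.
  by rewrite addnAC [X in (_ <= X)%N]addnC leq_add2r.
Qed.

End CardGlued.

(** * Good templates *)

Section Automorphisms.
Variable F : sgraph.
Implicit Types (f g : {perm F}) (A B C : {set F}).

Lemma automorphismP f :
  reflect (forall x y, adj (f x) (f y) = adj x y) (automorphism f).
Proof.
apply: (iffP forallP) => [f_adj x y|f_adj x]; last by apply/forallP => y; apply/eqP.
by have /forallP/(_ y)/eqP := f_adj x.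
Qed.

Lemma automorphism_embedding f : automorphism f -> embedding f.
Proof. by move/automorphismP; split; first exact: perm_inj. Qed.

Lemma automorphism1 : automorphism (1%g : {perm F}).
Proof. by apply/automorphismP => x y; rewrite !perm1. Qed.

Lemma automorphismM f g :
  automorphism f -> automorphism g -> automorphism (f * g)%g.
Proof.
move=> /automorphismP f_adj /automorphismP g_adj.
by apply/automorphismP => x y; rewrite !permM g_adj.
Qed.

Lemma automorphismV f : automorphism f -> automorphism f^-1%g.
Proof.
by move=> /automorphismP f_adj; apply/automorphismP => x y; rewrite -f_adj !permKV.
Qed.

Lemma aut_equivP A B :
  reflect (exists2 f : {perm F}, automorphism f & f @: A = B) (aut_equiv A B).
Proof.
apply: (iffP existsP) => [[f /andP[f_aut /eqP fA]]|[f f_aut fA]]; exists f => //.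
by rewrite f_aut fA eqxx.
Qed.

Lemma aut_equiv_refl A : aut_equiv A A.
Proof.
apply/aut_equivP; exists 1%g; first exact: automorphism1.
by rewrite -[RHS]imset_id; apply: eq_imset => x; rewrite perm1.
Qed.

Lemma aut_equiv_sym A B : aut_equiv A B -> aut_equiv B A.
Proof.
case/aut_equivP=> f f_aut <-; apply/aut_equivP; exists f^-1%g.
  exact: automorphismV.
by rewrite -imset_comp -[RHS]imset_id; apply: eq_imset => x /=; rewrite permK.
Qed.

Lemma aut_equiv_trans A B C : aut_equiv A B -> aut_equiv B C -> aut_equiv A C.
Proof.
case/aut_equivP=> f f_aut <- /aut_equivP[g g_aut <-]; apply/aut_equivP.
exists (f * g)%g; first exact: automorphismM.
by rewrite -imset_comp; apply: eq_imset => x; rewrite permM.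
Qed.

Lemma aut_classes_partition :
  partition (aut_classes F) [set A : {set F} | A != set0].
Proof.
apply: equivalence_partitionP => A B C _ _ _; split; first exact: aut_equiv_refl.
move=> AB; apply/idP/idP; apply: aut_equiv_trans => //.
exact: aut_equiv_sym.
Qed.

End Automorphisms.

Section ClassFunctional.
Variables (R : realType) (F : sgraph) (D : {set F} -> R).

Definition class_rep (C : aut_class F) : {set F} := odflt set0 [pick A in val C].

Definition class_functional (x : class_space R F) : R :=
  \sum_C x C * D (class_rep C).

Fact class_functional_is_linear : scalar class_functional.
Proof.
move=> a x y; rewrite /class_functional mulr_sumr -big_split.
by apply: eq_bigr => C _; rewrite !ffunE mulrDl mulrA.
Qed.

HB.instance Definition _ :=
  GRing.isLinear.Build R (class_space R F) R *%R class_functional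
    class_functional_is_linear.

Hypothesis D0 : D set0 = 0.
Hypothesis D_aut : forall (f : {perm F}) (A : {set F}),
  automorphism f -> D (f @: A) = D A.

Lemma class_functional_evec A : class_functional (evec R A) = D A.
Proof.
rewrite /class_functional /evec; have [->|A_neq0] := eqVneq A set0.
  by rewrite D0 big1// => C _; rewrite ffunE mul0r.
have triv := partition_trivIset (aut_classes_partition F).
pose cA := [set B in [set B : {set F} | B != set0] | aut_equiv A B].
have cA_class : cA \in aut_classes F by apply: imset_f; rewrite inE.
have AcA : A \in cA by rewrite !inE A_neq0 aut_equiv_refl.
rewrite (bigD1 (exist _ cA cA_class)) //= ffunE /= AcA mul1r big1 ?addr0.
  rewrite /class_rep; case: pickP => [B|/(_ A)]; last by rewrite /= AcA.
  by rewrite !inE => /andP[_ /aut_equivP[f f_aut <-]]; rewrite D_aut.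
move=> C; apply: contraNeq; rewrite ffunE mulf_eq0 negb_or pnatr_eq0 eqb0 negbK.
case/andP=> AC _; apply/eqP/val_inj => /=.
by rewrite -(def_pblock triv (valP C) AC) (def_pblock triv cA_class AcA).
Qed.

Lemma good_template_le (P : template F) :
  (forall A B C, disjoint3 (A, B, C) ->
     D (A :|: B :|: C) + D B <= D (A :|: B) + D (B :|: C)) ->
  good R P ->
  (nedges (glued P))%:R / (nedges F)%:R * D [set: F] <=
  \sum_s D (psiV P s) - \sum_(e in edges (tree P)) D (psiE P e).
Proof.
move=> D_submod [_ [c c_ge0 /(congr1 class_functional)]].
rewrite linearB linearZ linearB !(linear_sum class_functional) /=.
rewrite class_functional_evec; under eq_bigr do rewrite class_functional_evec.
under [X in _ - (_ - X)]eq_bigr do rewrite class_functional_evec.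
move=> zvecE; rewrite -subr_le0 zvecE; apply: sumr_le0 => -[[A B] C] ABC.
rewrite linearZ /= mulr_ge0_le0// /xvec linearD !linearB /= !class_functional_evec.
by have := D_submod A B C ABC; lra.
Qed.

End ClassFunctional.

(** * Densities of glued graphs *)

Definition edge_transitive (F : sgraph) : Prop :=
  {in edges F &, forall e e' : {set F},
    exists2 f : {perm F}, automorphism f & f @: e = e'}.

Definition sym_weight (R : numDomainType) (V : Type) (w : V -> V -> R) : Prop :=
  commutative w /\ forall x y, 0 <= w x y.

Section GibbsLaw.
Variables (R : realType) (V : finType) (w : V -> V -> R) (F : sgraph).
Hypothesis w_weight : sym_weight w.
Implicit Types (phi : {ffun F -> V}) (e : {set F}).

Let w_sym : commutative w := w_weight.1.
Let w_ge0 : forall x y, 0 <= w x y := w_weight.2.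

Definition partition_function : R := \sum_(phi : {ffun F -> V}) edge_prod w phi.

Definition gibbs_law phi : R := edge_prod w phi / partition_function.

Definition edge_energy (mu : {ffun F -> V} -> R) e : R :=
  \sum_phi mu phi * ln (edge_weight w phi e).

Lemma partition_function_ge0 : 0 <= partition_function.
Proof. by rewrite sumr_ge0// => phi _; exact: edge_prod_ge0. Qed.

Lemma dens_partition_function :
  dens w F = partition_function / (#|V| ^ #|F|)%:R.
Proof. by rewrite /dens /mean card_ffun. Qed.

Lemma gibbs_law_neq0 phi e :
  gibbs_law phi != 0 -> e \in edges F -> 0 < edge_weight w phi e.
Proof.
rewrite mulf_eq0 negb_or => /andP[+ _] eF; rewrite lt0r edge_weight_ge0// andbT.
by move/prodf_neq0; apply.
Qed.

Lemma gibbs_law_automorphism (f : {perm F}) phi :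
  automorphism f -> gibbs_law (precomp f phi) = gibbs_law phi.
Proof.
move=> f_aut; congr (_ / _); rewrite (eq_edge_prod _ (psi := phi \o f)); last first.
  by move=> u; rewrite ffunE.
rewrite (edge_prod_embed w_sym _ (automorphism_embedding f_aut)) -edge_prod_onT.
by congr edge_prod_on; apply/setP => u; rewrite inE -[u](permKV f) imset_f.
Qed.

Lemma edge_energy_imset (f : {perm F}) e : automorphism f -> e \in edges F ->
  edge_energy gibbs_law (f @: e) = edge_energy gibbs_law e.
Proof.
move=> f_aut eF; have f_emb := automorphism_embedding f_aut.
rewrite /edge_energy [RHS](reindex_inj (bij_inj (precomp_perm_bij V f))).
apply: eq_bigr => phi _; rewrite gibbs_law_automorphism// edge_weight_imset//.
by congr (_ * ln _); apply: eq_edge_weight => u _; rewrite ffunE.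
Qed.

Lemma edge_energy_transitive e e' : edge_transitive F ->
  e \in edges F -> e' \in edges F ->
  edge_energy gibbs_law e = edge_energy gibbs_law e'.
Proof.
move=> F_trans eF e'F; have [f f_aut <-] := F_trans e e' eF e'F.
by rewrite edge_energy_imset.
Qed.

Lemma sum_ln_edge_prod (S : finType) (mu : S -> R) (g : S -> {ffun F -> V}) :
  (forall s e, mu s != 0 -> e \in edges F -> 0 < edge_weight w (g s) e) ->
  \sum_s mu s * ln (edge_prod w (g s)) =
  \sum_(e in edges F) \sum_s mu s * ln (edge_weight w (g s) e).
Proof.
move=> weight_gt0; rewrite exchange_big; apply: eq_bigr => s _.
have [->|mus] := eqVneq (mu s) 0; first by rewrite mul0r big1// => e _; rewrite mul0r.
by rewrite -mulr_sumr ln_prod// => e eF; exact: weight_gt0.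
Qed.

Hypothesis Z_gt0 : 0 < partition_function.

Lemma gibbs_law_is_law : is_law gibbs_law.
Proof.
split; last by rewrite -mulr_suml divff// gt_eqF.
by move=> phi; rewrite divr_ge0 ?partition_function_ge0 ?edge_prod_ge0.
Qed.

Lemma ln_partition_function :
  ln partition_function =
  entropy gibbs_law + \sum_(e in edges F) edge_energy gibbs_law e.
Proof.
rewrite -sum_ln_edge_prod; last exact: gibbs_law_neq0.
by rewrite -gibbs_eq// => phi; exact: edge_prod_ge0.
Qed.

End GibbsLaw.

Section GluedLaw.
Variables (R : realType) (V : finType) (w : V -> V -> R) (F : sgraph).
Variables (P : template F) (mu : {ffun F -> V} -> R).
Variable nu : {ffun tree P -> {ffun F -> option V}} -> R.
Variable v0 : V.
Hypothesis w_weight : sym_weight w.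
Hypothesis mu_gt0 : forall phi e,
  mu phi != 0 -> e \in edges F -> 0 < edge_weight w phi e.
Hypothesis nu_tree_law : tree_law mu [set: tree P] nu.
Local Notation T := (tree P).
Local Notation J := (glued P).
Implicit Types (G : {ffun T -> {ffun F -> option V}}) (s t : T) (C : J).

Definition glued_map G : {ffun J -> V} :=
  [ffun C : J => if [pick p in val C] is Some p then odflt v0 (G p.1 p.2) else v0].

Lemma row_restriction G s : nu G != 0 ->
  exists2 phi, mu phi != 0 & G s = restriction (psiV P s) phi.
Proof.
have [nu_law nu_marg _ _] := nu_tree_law => nuG.
have : law mu (restriction (psiV P s)) (G s) != 0.
  by rewrite -nu_marg ?inE// gt_eqF// (law_gt0 _ nu_law nuG).
by case/law_neq0=> phi muphi phiE; exists phi.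
Qed.

Lemma connect_identified_eq G (p q : T * F) : nu G != 0 ->
  connect (@identified F P) p q -> G p.1 p.2 = G q.1 q.2.
Proof.
have [_ _ nu_cons _] := nu_tree_law => /nu_cons[_ G_cons] /connectP[c].
elim: c p => [|[t v] c IHc] [s u] /=; first by move=> _ ->.
case/andP=> /and3P[/= st /eqP <- uP] t_path qE; rewrite -(IHc _ t_path qE) /=.
by have /ffunP/(_ u) := G_cons s t (in_setT s) (in_setT t) st; rewrite !ffunE uP.
Qed.

Lemma glued_mapE G C (p : T * F) : nu G != 0 -> p \in val C ->
  p \in copies P /\ G p.1 p.2 = Some (glued_map G C).
Proof.
move=> nuG; have /imsetP[r _ CE] := valP C; rewrite CE inE => /andP[pP rp].
split=> //; have [phi _ rowE] := row_restriction p.1 nuG.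
have GpE : G p.1 p.2 = Some (phi p.2).
  by move: pP; rewrite rowE inE => /restriction_in->.
rewrite ffunE; case: pickP => [q|/(_ p)] /=; rewrite CE inE; last by rewrite rp pP.
case/andP=> _ rq; rewrite -(connect_identified_eq nuG rq).
by rewrite (connect_identified_eq nuG rp) GpE.
Qed.

Lemma glued_map_inj : {in [pred G | nu G != 0] &, injective glued_map}.
Proof.
move=> G G'; rewrite !inE => nuG nuG' eq_map; apply/ffunP => s; apply/ffunP => v.
have [vs|vNs] := boolP (v \in psiV P s); last first.
  have [phi _ ->] := row_restriction s nuG; have [phi' _ ->] := row_restriction s nuG'.
  by rewrite !ffunE (negbTE vNs).
have class_glued : glued_class (s, v) \in glued_classes P by rewrite imset_f ?inE.
pose C : J := exist (fun A => A \in glued_classes P) _ class_glued.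
have svC : (s, v) \in val C by rewrite !inE vs connect0.
have [_ /= ->] := glued_mapE nuG svC; have [_ /= ->] := glued_mapE nuG' svC.
by rewrite eq_map.
Qed.

Lemma glued_edge (e : {set J}) : e \in edges J ->
  exists s u v, [/\ [set u; v] \in edges F, u \in psiV P s, v \in psiV P s &
    forall G phi, nu G != 0 -> G s = restriction (psiV P s) phi ->
      edge_weight w (glued_map G) e = edge_weight w phi [set u; v]].
Proof.
have [w_sym _] := w_weight; case/edgesP=> A [B [AB ->]].
have /existsP[s /existsP[u /existsP[v /and3P[su sv uv]]]] := AB.
have [G0 nuG0] := exists_law_neq0 (let: And4 nu_law _ _ _ := nu_tree_law in nu_law).
have [us _] := glued_mapE nuG0 su; have [vs _] := glued_mapE nuG0 sv.
rewrite !inE /= in us vs.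
exists s, u, v; split; rewrite ?mem_edges// => G phi nuG rowE.
have [_ /=] := glued_mapE nuG su; have [_ /=] := glued_mapE nuG sv.
rewrite rowE !restriction_in// => -[vE] [uE].
by rewrite !edge_weightE// uE vE.
Qed.

Lemma glued_edge_weight_gt0 G (e : {set J}) :
  nu G != 0 -> e \in edges J -> 0 < edge_weight w (glued_map G) e.
Proof.
move=> nuG /glued_edge[s [u [v [uv _ _ weightE]]]].
have [phi muphi rowE] := row_restriction s nuG.
by rewrite (weightE G phi nuG rowE) mu_gt0.
Qed.

Lemma glued_edge_energy (e : {set J}) : e \in edges J ->
  exists2 e', e' \in edges F &
    \sum_G nu G * ln (edge_weight w (glued_map G) e) = edge_energy w mu e'.
Proof.
move=> /glued_edge[s [u [v [uv us vs weightE]]]]; exists [set u; v] => //.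
have [_ nu_marg _ _] := nu_tree_law; have [w_sym _] := w_weight.
pose f (r : {ffun F -> option V}) := ln (w (odflt v0 (r u)) (odflt v0 (r v))).
transitivity (\sum_G nu G * f (G s)).
  apply: eq_bigr => G _; have [->|nuG] := eqVneq (nu G) 0; first by rewrite !mul0r.
  have [phi _ rowE] := row_restriction s nuG.
  rewrite (weightE G phi nuG rowE) edge_weightE -?mem_edges// /f rowE.
  by rewrite !restriction_in.
rewrite -(sum_lawM _ (fun G => G s)) nu_marg ?inE// sum_lawM.
apply: eq_bigr => phi _; rewrite edge_weightE -?mem_edges// /f.
by rewrite !restriction_in.
Qed.

Lemma partition_function_glued_gt0 : 0 < partition_function w J.
Proof.
have [nu_law _ _ _] := nu_tree_law; have [_ w_ge0] := w_weight.
have [G nuG] := exists_law_neq0 nu_law.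
rewrite /partition_function (bigD1 (glued_map G))//= ltr_pwDl//.
  by apply: prodr_gt0 => e; exact: glued_edge_weight_gt0.
by rewrite sumr_ge0// => theta _; exact: edge_prod_ge0.
Qed.

(* Gibbs' inequality for the law of the glued map. *)
Lemma glued_gibbs_le (l : R) :
  (forall e, e \in edges F -> edge_energy w mu e = l) ->
  \sum_s set_entropy mu (psiV P s) - \sum_(e in edges T) set_entropy mu (psiE P e) +
    (nedges J)%:R * l <= ln (partition_function w J).
Proof.
move=> energyE; have [nu_law _ _ nu_ent] := nu_tree_law.
have [_ w_ge0] := w_weight.
have := gibbs_le (nu := law nu glued_map) (a := fun theta => edge_prod w theta).
rewrite (entropy_law_inj glued_map_inj).
rewrite (sum_lawM _ _ (fun theta : {ffun J -> V} => ln (edge_prod w theta))).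
rewrite sum_ln_edge_prod; last by move=> G e; exact: glued_edge_weight_gt0.
rewrite (eq_bigr (fun=> l)) => [|e /glued_edge_energy[e' e'F ->]]; last exact: energyE.
have -> : entropy nu = \sum_s set_entropy mu (psiV P s) -
    \sum_(e in edges T) set_entropy mu (psiE P e).
  rewrite nu_ent; congr (_ - _); apply: eq_bigl => x; first by rewrite inE.
  by rewrite subsetT andbT.
rewrite sumr_const mulr_natl; apply=> [|theta|theta /law_neq0[G nuG <-]].
- exact: law_is_law.
- exact: edge_prod_ge0.
- by apply: prodr_gt0 => e; exact: glued_edge_weight_gt0.
Qed.

End GluedLaw.

Section DensGlued.
Variables (R : realType) (V : finType) (w : V -> V -> R) (F : sgraph).
Variable P : template F.
Hypothesis V_gt0 : (0 < #|V|)%N.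
Hypothesis w_weight : sym_weight w.
Hypothesis F_trans : edge_transitive F.
Hypothesis F_edges : (0 < nedges F)%N.
Hypothesis P_good : good R P.
Local Notation J := (glued P).
Local Notation mu := (gibbs_law w (F := F)).

(* The entropy of the restriction to A, relative to the uniform law. *)
Definition rel_entropy (nu : {ffun F -> V} -> R) (A : {set F}) : R :=
  set_entropy nu A - #|A|%:R * ln #|V|%:R.

Lemma rel_entropy_submodular (nu : {ffun F -> V} -> R) A B C : is_law nu ->
  disjoint3 (A, B, C) ->
  rel_entropy nu (A :|: B :|: C) + rel_entropy nu B <=
  rel_entropy nu (A :|: B) + rel_entropy nu (B :|: C).
Proof.
move=> nu_law /and3P[/= AB AC BC]; rewrite /rel_entropy.
have cardU (X Y : {set F}) : [disjoint X & Y] -> #|X :|: Y| = (#|X| + #|Y|)%N.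
  by move=> XY; rewrite cardsU disjoint_setI0// cards0 subn0.
rewrite -setUA !cardU//; last first.
  by rewrite -setI_eq0 setIUr setU_eq0 !setI_eq0 AB AC.
rewrite setUA !natrD.
by have := set_entropy_submodular nu_law A B C; lra.
Qed.

Lemma rel_entropy_automorphism (f : {perm F}) (A : {set F}) : automorphism f ->
  rel_entropy mu (f @: A) = rel_entropy mu A.
Proof.
move=> f_aut; rewrite /rel_entropy card_imset; last exact: perm_inj.
by rewrite set_entropy_imset// => phi; exact: gibbs_law_automorphism.
Qed.

Lemma ln_dens (G : sgraph) : 0 < partition_function w G ->
  ln (dens w G) = ln (partition_function w G) - #|G|%:R * ln #|V|%:R.
Proof.
move=> Z_gt0; have cardV_gt0 : 0 < #|V|%:R :> R by rewrite ltr0n.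
rewrite dens_partition_function natrX ln_div ?posrE ?exprn_gt0//.
by rewrite lnXn// mulr_natl.
Qed.

Lemma partition_function_gt0 (G : sgraph) :
  (0 < partition_function w G) = (dens w G != 0).
Proof.
rewrite lt0r (partition_function_ge0 _ w_weight) andbT dens_partition_function.
by rewrite mulf_eq0 invr_eq0 pnatr_eq0 expn_eq0 -[#|V| == 0%N]negbK -lt0n V_gt0 orbF.
Qed.

Lemma sum_rel_entropy_le (nu : {ffun F -> V} -> R) :
  \sum_s rel_entropy nu (psiV P s) -
  \sum_(e in edges (tree P)) rel_entropy nu (psiE P e) <=
  \sum_s set_entropy nu (psiV P s) -
  \sum_(e in edges (tree P)) set_entropy nu (psiE P e) - #|J|%:R * ln #|V|%:R.
Proof.
have ln_ge0 : 0 <= ln #|V|%:R :> R by rewrite ln_ge0// ler1n.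
have := card_glued P; rewrite -(ler_nat R) natrD => /(ler_wpM2r ln_ge0).
by rewrite /rel_entropy !sumrB -!mulr_suml -!natr_sum mulrDl; lra.
Qed.

Lemma ln_dens_glued_le : dens w F != 0 ->
  dens w J != 0 /\
  (nedges J)%:R / (nedges F)%:R * ln (dens w F) <= ln (dens w J).
Proof.
rewrite -partition_function_gt0 => ZF_gt0.
have mu_law := gibbs_law_is_law w_weight ZF_gt0.
have mu_gt0 phi e : mu phi != 0 -> e \in edges F -> 0 < edge_weight w phi e.
  exact: gibbs_law_neq0.
have [nu nu_tree_law] := exists_tree_law P mu_law.
have /card_gt0P[v0 _] := V_gt0; have /card_gt0P[e0 e0F] := F_edges.
pose l := edge_energy w mu e0.
have energyE e : e \in edges F -> edge_energy w mu e = l.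
  by move=> eF; exact: edge_energy_transitive.
have ZJ_gt0 := partition_function_glued_gt0 v0 w_weight mu_gt0 nu_tree_law.
split; first by rewrite -partition_function_gt0.
have ln_dens_F : ln (dens w F) = rel_entropy mu [set: F] + (nedges F)%:R * l.
  rewrite ln_dens// ln_partition_function// (eq_bigr (fun=> l))//.
  by rewrite sumr_const -[l *+ _]mulr_natl /rel_entropy set_entropyT cardsT addrAC.
rewrite ln_dens_F ln_dens// mulrDr mulrA divfK ?pnatr_eq0 -?lt0n//.
have := glued_gibbs_le v0 w_weight mu_gt0 nu_tree_law energyE.
have := sum_rel_entropy_le mu.
suff : (nedges J)%:R / (nedges F)%:R * rel_entropy mu [set: F] <=
  \sum_s rel_entropy mu (psiV P s) -
  \sum_(e in edges (tree P)) rel_entropy mu (psiE P e) by lra.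
apply: good_template_le P_good => [|f A|A B C].
- by rewrite /rel_entropy set_entropy0// cards0 mul0r subr0.
- exact: rel_entropy_automorphism.
- exact: rel_entropy_submodular.
Qed.

Lemma dens_glued : dens w F ^+ nedges J <= dens w J ^+ nedges F.
Proof.
have [_ w_ge0] := w_weight; have [J_edges _] := P_good.
have [->|dF_neq0] := eqVneq (dens w F) 0.
  by rewrite expr0n gtn_eqF//= exprn_ge0// dens_ge0.
have [dJ_neq0 ln_le] := ln_dens_glued_le dF_neq0.
have [dF_gt0 dJ_gt0] : 0 < dens w F /\ 0 < dens w J.
  by rewrite !lt0r !dens_ge0// dF_neq0 dJ_neq0.
rewrite -ler_ln ?posrE ?exprn_gt0// !lnXn// -[_ *+ nedges J]mulr_natr.
rewrite -[_ *+ nedges F]mulr_natr -ler_pdivrMr ?ltr0n//.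
by move: ln_le; rewrite mulrAC [_ * ln _]mulrC.
Qed.

End DensGlued.

Lemma cycle_edge_transitive (m : nat) :
  (3 <= m)%N -> edge_transitive (cycle_graph m).
Proof.
move=> m_ge3; have m_gt0 : (0 < m)%N by apply: leq_trans m_ge3.
pose shift (k : nat) (i : 'I_m) : 'I_m := Ordinal (ltn_pmod (i + k) m_gt0).
have shift_inj k : injective (shift k).
  move=> i j /(congr1 val) /= /eqP; rewrite eqn_modDr !modn_small// => /eqP.
  exact: val_inj.
have shiftS k i : shift k (ordS i) = ordS (shift k i).
  by apply: val_inj; rewrite /= modnDml -[in RHS]addn1 modnDml addSn addn1.
pose rotation k : {perm cycle_graph m} := perm (@shift_inj k).
have rotation_aut k : automorphism (rotation k).
  apply/automorphismP => i j.
  by rewrite !cycle_adjE// !permE -!shiftS !(inj_eq (@shift_inj k)).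
move=> e e'; rewrite edges_cycle// => /imsetP[i _ ->] /imsetP[j _ ->].
exists (rotation (j + (m - i))%N) => //.
have shift_ij : shift (j + (m - i))%N i = j.
  apply: val_inj; rewrite /= addnCA subnKC ?(ltnW (ltn_ord _))//.
  by rewrite modnDr modn_small.
by rewrite imsetU1 imset_set1 !permE shiftS shift_ij.
Qed.

(** * The inequality for finite weights *)

Lemma weighted_amgm (R : realFieldType) (x y z c : R) (a b n : nat) :
  0 <= x -> 0 <= y -> 0 <= z -> 0 <= c -> (0 < a + b + n)%N ->
  c ^+ (a + b + n) <= x ^+ a * y ^+ b * z ^+ n ->
  (a + b + n)%:R * c <= a%:R * x + b%:R * y + n%:R * z.
Proof.
move=> x_ge0 y_ge0 z_ge0 c_ge0 abn_gt0 le_c.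
pose E (i : 'I_a + 'I_b + 'I_n) : R :=
  match i with inl (inl _) => x | inl (inr _) => y | inr _ => z end.
have E_ge0 i : 0 <= E i by case: i => [[]|].
have cardE : #|{: 'I_a + 'I_b + 'I_n}| = (a + b + n)%N by rewrite !card_sum !card_ord.
have [amgm _] := leif_AGM (A := {: 'I_a + 'I_b + 'I_n}) (fun i _ => E_ge0 i).
rewrite cardE !big_sumType /= !prodr_const !sumr_const !card_ord in amgm.
have := le_trans le_c amgm; rewrite ler_pXn2r ?nnegrE//; last first.
  by rewrite divr_ge0// !addr_ge0// mulrn_wge0.
by rewrite ler_pdivlMr ?ltr0n// mulrC !mulr_natl.
Qed.

Lemma bernoulli_le (R : realDomainType) (z : R) (k : nat) :
  0 <= z -> 1 + k%:R * (z - 1) <= z ^+ k.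
Proof.
move=> z_ge0; elim: k => [|k IHk]; first by rewrite mul0r addr0.
rewrite exprS; apply: le_trans (ler_wpM2l z_ge0 IHk).
have : 0 <= k%:R * (z - 1) ^+ 2 :> R by rewrite mulr_ge0// sqr_ge0.
by rewrite -natr1; lra.
Qed.

Section OneColour.
Variables (R : realFieldType) (e l m : nat).
Hypotheses (m_gt0 : (0 < m)%N) (m_le_e : (m <= e)%N).

Lemma one_colour_normalised_ge (x y z : R) : 0 <= x -> 0 <= y -> 0 <= z ->
  z ^+ (e + l) <= (x * y ^+ l) ^+ m ->
  m%:R + (e + l)%:R * (z - y ^+ m) + e%:R * m%:R * (y - 1) <= m%:R * x.
Proof.
move=> x_ge0 y_ge0 z_ge0 le_z.
have exponentE : (m + l + (e - m) = e + l)%N by lia.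
have := @weighted_amgm R x (y ^+ m) 1 z m l (e - m)%N.
rewrite exponentE addn_gt0 (leq_trans m_gt0 m_le_e) expr1n !mulr1 exprn_ge0//.
rewrite -exprM [(m * l)%N]mulnC exprM -exprMn natrB// => /(_ _ _ _ _ _ le_z) amgm.
have := amgm x_ge0 isT ler01 z_ge0 isT.
have := ler_wpM2l (ler0n R e) (bernoulli_le m y_ge0).
by rewrite natrD; lra.
Qed.

(* [c], [d] and [t] stand for the densities of the m-cycle, the edge and H. *)
Lemma one_colour_density_ge (t c d p : R) : 0 <= t -> 0 <= c -> 0 <= d -> 0 < p ->
  c ^+ (e + l) <= (t * d ^+ l) ^+ m ->
  p / e%:R + (e + l)%:R / (e%:R * p ^+ m.-1) * ((c - d ^+ m) / m%:R) + (d - p) <=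
  t / (e%:R * p ^+ e.-1).
Proof.
move=> t_ge0 c_ge0 d_ge0 p_gt0 le_c.
have e_gt0 := leq_trans m_gt0 m_le_e; have p_ge0 := ltW p_gt0.
have bound : m%:R + (e + l)%:R * (c / p ^+ m - (d / p) ^+ m) +
    e%:R * m%:R * (d / p - 1) <= m%:R * (t / p ^+ e).
  apply: one_colour_normalised_ge; rewrite ?divr_ge0 ?exprn_ge0//.
  rewrite [(d / p) ^+ l]expr_div_n mulf_div -exprD !expr_div_n -!exprM.
  by rewrite [(m * _)%N]mulnC ler_pM2r// invr_gt0 exprn_gt0.
have [p_neq0 e_neq0 m_neq0] : [/\ p != 0, e%:R != 0 :> R & m%:R != 0 :> R].
  by rewrite gt_eqF// !pnatr_eq0 -!lt0n.
have pXE k : (0 < k)%N -> p ^+ k = p * p ^+ k.-1 by case: k => // k _; rewrite exprS.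
have pX_neq0 k : p ^+ k != 0 by rewrite expf_neq0.
have scale_ge0 : 0 <= p / (e%:R * m%:R) by rewrite divr_ge0 ?mulr_ge0.
have -> : t / (e%:R * p ^+ e.-1) = p / (e%:R * m%:R) * (m%:R * (t / p ^+ e)).
  by rewrite (pXE e)//; field; rewrite p_neq0 e_neq0 m_neq0 pX_neq0.
apply: le_trans (ler_wpM2l scale_ge0 bound); rewrite le_eqVlt; apply/predU1P; left.
rewrite expr_div_n (pXE m)// natrD; field.
by rewrite p_neq0 e_neq0 m_neq0 pX_neq0.
Qed.

End OneColour.

Section FiniteInequality.
Variables (R : realType) (m : nat).
Hypotheses (m_ge3 : (3 <= m)%N) (m_odd : odd m).

Let m_gt0 : (0 < m)%N.
Proof. exact: leq_trans m_ge3. Qed.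

Lemma dens_deletion_ge (V : finType) (w : V -> V -> R)
    (P : template (cycle_graph m)) (H : sgraph) (l : nat) (p : R) :
  (0 < #|V|)%N -> sym_weight w -> good R P ->
  obtained_by_deletion (glued P) l H -> (m <= nedges H)%N -> 0 < p ->
  p / (nedges H)%:R +
  (nedges H + l)%:R / ((nedges H)%:R * p ^+ m.-1) *
    ((dens w (cycle_graph m) - edge_dens w ^+ m) / m%:R) +
  (edge_dens w - p) <=
  dens w H / ((nedges H)%:R * p ^+ (nedges H).-1).
Proof.
move=> V_gt0 w_weight P_good H_del H_edges p_gt0; have [w_sym w_ge0] := w_weight.
apply: one_colour_density_ge; rewrite ?dens_ge0 ?edge_dens_ge0//.
rewrite -(dens_deletion V_gt0 w_sym H_del) -(nedges_deletion H_del).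
rewrite -{4}(nedges_cycle m_ge3); apply: dens_glued => //.
  exact: cycle_edge_transitive.
by rewrite nedges_cycle.
Qed.

Lemma finite_common (n : nat) (w1 w2 : 'I_n.+1 -> 'I_n.+1 -> R)
    (P1 P2 : template (cycle_graph m)) (H1 H2 : sgraph) (l1 l2 : nat) (p1 p2 : R) :
  sym_weight w1 -> sym_weight w2 -> (forall x y, w1 x y + w2 x y = 1) ->
  good R P1 -> good R P2 ->
  obtained_by_deletion (glued P1) l1 H1 -> obtained_by_deletion (glued P2) l2 H2 ->
  (m <= nedges H1)%N -> (m <= nedges H2)%N ->
  0 < p1 -> 0 < p2 -> p1 + p2 = 1 ->
  (nedges H1 + l1)%:R / ((nedges H1)%:R * p1 ^+ m.-1) =
  (nedges H2 + l2)%:R / ((nedges H2)%:R * p2 ^+ m.-1) ->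
  p1 / (nedges H1)%:R + p2 / (nedges H2)%:R <=
  dens w1 H1 / ((nedges H1)%:R * p1 ^+ (nedges H1).-1) +
  dens w2 H2 / ((nedges H2)%:R * p2 ^+ (nedges H2).-1).
Proof.
move=> w1_weight w2_weight w12 good1 good2 del1 del2 H1_edges H2_edges p1_gt0 p2_gt0.
move=> p12 balance; have V_gt0 : (0 < #|'I_n.+1|)%N by rewrite card_ord.
have bound1 := dens_deletion_ge V_gt0 w1_weight good1 del1 H1_edges p1_gt0.
have bound2 := dens_deletion_ge V_gt0 w2_weight good2 del2 H2_edges p2_gt0.
apply: le_trans (lerD bound1 bound2); rewrite balance.
set ratio := (_ + _)%:R / _.
have ratio_ge0 : 0 <= ratio by rewrite divr_ge0// mulr_ge0// exprn_ge0// ltW.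
have edge12 := edge_dens_complement V_gt0 w12.
rewrite [leRHS]addrACA [X in _ <= X + _]addrACA [X in _ <= _ + X]addrACA.
rewrite -opprD edge12 p12 subrr addr0.
rewrite -mulrDr lerDl mulr_ge0// -mulrDl divr_ge0// addrACA -opprD subr_ge0.
by apply: odd_cycle_goodman => //; [case: w1_weight|case: w2_weight].
Qed.

End FiniteInequality.

(** * Marginals of the cube *)

Import classical_sets.

Lemma big_extend_inj (M : Type) (idx : M) (op : Monoid.com_law idx)
    (I J : finType) (h : I -> J) (f : J -> M) :
  injective h -> (forall j, j \notin codom h -> f j = idx) ->
  \big[op/idx]_j f j = \big[op/idx]_i f (h i).
Proof.
move=> h_inj f_out; rewrite (bigID (mem (codom h))) /=.
rewrite [X in op _ X]big1// Monoid.mulm1.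
have codom_uniq : uniq (codom h) by rewrite map_inj_uniq ?enum_uniq.
by rewrite -big_uniq// big_image.
Qed.

Section CubeMarginals.
Local Open Scope classical_set_scope.
Variable R : realType.
Local Notation mR := (measurableTypeR R).
Local Notation lambda := (uniform_prob (@ltr01 R)).

Definition box n (B : 'I_n -> set mR) : set (n.-tuple mR) :=
  [set x | forall i, B i (tnth x i)].

Lemma measurable_box n (B : 'I_n -> set mR) :
  (forall i, measurable (B i)) -> measurable (box B).
Proof.
move=> mB.
rewrite (_ : box B = \bigcap_(i in [set: 'I_n]) ((@tnth n mR)^~ i @^-1` B i)).
  apply: fin_bigcap_measurable; first exact: finite_finset.
  move=> i _; rewrite -[X in measurable X]setTI.
  exact: (@measurable_tnth _ mR n i).
by apply/seteqP; split=> [x Bx i _|x Bx i]; exact: Bx.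
Qed.

Lemma box_cons n (B : 'I_n.+1 -> set mR) :
  @tuple_cons R n @^-1` box B = B ord0 `*` box (fun i => B (lift ord0 i)).
Proof.
apply/seteqP; split=> [[a x] Bx|[a x] [/= Ba Bx] i]; rewrite /tuple_cons /=.
  by split=> [|i]; [exact: (Bx ord0)|have := Bx (lift ord0 i); rewrite tnthS].
by case: (unliftP ord0 i) => [j|] ->; [rewrite tnthS; exact: Bx|].
Qed.

Lemma cube_prob_box n (B : 'I_n -> set mR) : (forall i, measurable (B i)) ->
  cube_prob R n (box B) = (\prod_(i < n) fine (lambda (B i)))%:E.
Proof.
elim: n B => [|n IHn] B mB; first by rewrite big_ord0 /= diracE mem_set// => -[].
rewrite big_ord_recl /= /distribution /pushforward /= box_cons.
rewrite product_measure1E//; last by apply: measurable_box => i.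
transitivity (lambda (B ord0) *
    (\prod_(i < n) fine (lambda (B (lift ord0 i))))%:E)%E.
  by congr (_ * _)%E; exact: IHn.
by rewrite EFinM fineK// fin_num_measure.
Qed.

Lemma measurable_boxes n :
  @measurable _ (n.-tuple mR) =
  <<s [set box B | B in [set B : 'I_n -> set mR | forall i, measurable (B i)]] >>.
Proof.
apply/seteqP; split; last first.
  apply: smallest_sub; first exact: sigma_algebra_measurable.
  by move=> _ [B mB <-]; exact: measurable_box.
apply: smallest_sub; first exact: smallest_sigma_algebra.
elim/big_ind: _ => [//|A B sA sB|i _ _ [C mC <-]]; first by rewrite subUset.
apply: sub_sigma_algebra.
exists (fun j => if j == i then C else setT); first by move=> j; case: ifP.
apply/seteqP; split=> [x Bx|x [_ Cx] j].
  by split=> //; have := Bx i; rewrite eqxx.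
by case: ifP => // /eqP->.
Qed.

Section Selection.
Variables (k n : nat) (h : 'I_k -> 'I_n).

Definition tuple_sel (x : n.-tuple mR) : k.-tuple mR := [tuple tnth x (h j) | j < k].

Lemma measurable_tuple_sel : measurable_fun setT tuple_sel.
Proof.
apply/measurable_fun_tnthP => j.
rewrite (_ : _ \o _ = (@tnth n mR)^~ (h j)); first exact: measurable_tnth.
by apply/funext => x /=; rewrite tnth_mktuple.
Qed.

HB.instance Definition _ :=
  isMeasurableFun.Build _ _ _ _ tuple_sel measurable_tuple_sel.

Definition sel_sides (B : 'I_k -> set mR) (i : 'I_n) : set mR :=
  if [pick j | h j == i] is Some j then B j else setT.

Hypothesis h_inj : injective h.

Lemma sel_sidesE B j : sel_sides B (h j) = B j.
Proof. by rewrite /sel_sides; case: pickP => [j' /eqP/h_inj->//|/(_ j)/eqP]. Qed.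

Lemma sel_sides_out B i : i \notin codom h -> sel_sides B i = setT.
Proof.
rewrite /sel_sides; case: pickP => // j /eqP <-.
by rewrite codom_f.
Qed.

Lemma tuple_sel_box B : tuple_sel @^-1` box B = box (sel_sides B).
Proof.
apply/seteqP; split=> [x Bx i|x Bx j]; last by rewrite tnth_mktuple -sel_sidesE.
rewrite /sel_sides; case: pickP => // j /eqP <-.
by have := Bx j; rewrite tnth_mktuple.
Qed.

Lemma cube_prob_sel_box (B : 'I_k -> set mR) : (forall j, measurable (B j)) ->
  cube_prob R n (tuple_sel @^-1` box B) = cube_prob R k (box B).
Proof.
move=> mB; rewrite tuple_sel_box !cube_prob_box//; last first.
  by move=> i; rewrite /sel_sides; case: pickP.
rewrite (big_extend_inj _ h_inj) => [|i hi]; last first.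
  by rewrite sel_sides_out// probability_setT.
by congr (_%:E); apply: eq_bigr => j _; rewrite sel_sidesE.
Qed.

(* Boxes form a pi-system that generates the measurable sets. *)
Lemma distribution_tuple_sel (A : set (k.-tuple mR)) : measurable A ->
  distribution (cube_prob R n) tuple_sel A = cube_prob R k A.
Proof.
apply: (measure_unique
  [set box B | B in [set B : 'I_k -> set mR | forall i, measurable (B i)]]
  (fun=> setT)).
- exact: measurable_boxes.
- move=> _ _ [B mB <-] [C mC <-]; exists (fun i => B i `&` C i).
    by move=> i; apply: measurableI.
  apply/seteqP; split=> [x BCx|x [Bx Cx] i]; last by split.
  by split=> i; have [] := BCx i.
- by move=> _; exists (fun=> setT) => //; apply/seteqP.
- by rewrite bigcup_const.
- by move=> _ [B mB <-]; exact: cube_prob_sel_box.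
- move=> _; apply: (le_lt_trans _ (ltry 1)).
  exact: (@probability_le1 _ _ _ (distribution (cube_prob R n) tuple_sel)).
Qed.

Lemma integral_tuple_sel (f : k.-tuple mR -> R) :
  measurable_fun [set: k.-tuple mR] f -> (forall y, 0 <= f y) ->
  (\int[cube_prob R n]_x (f (tuple_sel x))%:E = \int[cube_prob R k]_y (f y)%:E)%E.
Proof.
move=> mf f_ge0.
transitivity (\int[distribution (cube_prob R n) tuple_sel]_y (f y)%:E)%E.
  by rewrite ge0_integral_distribution//; exact/measurable_EFinP.
by apply: eq_measure_integral => A mA _; exact: distribution_tuple_sel.
Qed.

End Selection.

End CubeMarginals.

(** * Sampling from a graphon *)

Lemma mean_not_injective_le (R : numFieldType) (V A : finType) : (0 < #|V|)%N ->
  mean (fun phi : {ffun A -> V} => (~~ injectiveb phi)%:R) <=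
  (#|A| ^ 2)%:R / #|V|%:R :> R.
Proof.
move=> V_gt0; have V_neq0 : #|V|%:R != 0 :> R by rewrite pnatr_eq0 -lt0n.
pose same (p : A * A) (phi : {ffun A -> V}) : R := (phi p.1 == phi p.2)%:R.
have same_mean p : p.1 != p.2 -> mean (same p) = #|V|%:R^-1.
  move=> /(edge_densE (fun x y => (x == y)%:R : R) V_gt0) ->.
  rewrite /edge_dens /mean card_prod natrM invfM mulrA.
  rewrite -(pair_bigA _ (fun x y : V => (x == y)%:R)) (eq_bigr (fun=> 1)).
    by rewrite sumr_const divff// mul1r.
  move=> x _; rewrite (bigD1 x)//= eqxx big1 ?addr0// => y.
  by rewrite eq_sym => /negbTE->.
apply: (@le_trans _ _ (mean (fun phi => \sum_(p : A * A | p.1 != p.2) same p phi))).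
  apply: ler_mean => phi; have [inj_phi|] := boolP (injectiveb phi).
    by apply: sumr_ge0 => p _; exact: ler0n.
  case/injectivePn=> x [y xNy eq_phi]; rewrite (bigD1 (x, y))//= /same/= eq_phi eqxx.
  by rewrite lerDl sumr_ge0// => p _; exact: ler0n.
rewrite mean_sum (eq_bigr _ same_mean) sumr_const -[_ *+ _]mulr_natl.
rewrite ler_wpM2r ?invr_ge0 ?ler0n// ler_nat -mulnn -card_prod.
exact: max_card.
Qed.

Section BoundedIntegrals.
Local Open Scope classical_set_scope.
Context (d : measure_display) (T : measurableType d) (R : realType).
Variables (P : probability T R) (D : set T).
Hypothesis mD : measurable D.

Lemma integrable_unit_valued (f : T -> R) : measurable_fun D f ->
  (forall x, 0 <= f x <= 1) -> P.-integrable D (EFin \o f).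
Proof.
move=> mf f01; apply: measurable_bounded_integrable => //.
  by rewrite (le_lt_trans (probability_le1 P mD))// ltry.
exists 1; split; first exact: num_real.
move=> M M1 x _; have /andP[f_ge0 f_le1] := f01 x.
by rewrite /= ger0_norm// (le_trans f_le1)// ltW.
Qed.

Lemma integrable_Rsum (I : finType) (f : I -> T -> R) :
  (forall i, P.-integrable D (EFin \o f i)) ->
  P.-integrable D (EFin \o (fun x => \sum_i f i x)).
Proof.
move=> fi; rewrite (_ : _ \o _ = (fun x => \sum_i (f i x)%:E)%E).
  by apply: (integrable_sum mD) => i _; exact: fi.
by apply/funext => x /=; rewrite sumEFin.
Qed.

Lemma integrable_mean (I : finType) (f : I -> T -> R) :
  (forall i, P.-integrable D (EFin \o f i)) ->
  P.-integrable D (EFin \o (fun x => mean (f^~ x))).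
Proof. by move=> fi; exact: (integrableZr mD #|I|%:R^-1 (integrable_Rsum fi)). Qed.

Lemma Rintegral_mean (I : finType) (f : I -> T -> R) :
  (forall i, P.-integrable D (EFin \o f i)) ->
  \int[P]_(x in D) mean (f^~ x) = mean (fun i => \int[P]_(x in D) f i x).
Proof.
move=> fi; rewrite /mean RintegralZr//; last exact: integrable_Rsum.
congr (_ / _); rewrite /Rintegral; under eq_integral do rewrite -sumEFin.
rewrite (integral_sum mD fi) sum_fine// => i _.
exact: (integrable_fin_num mD (fi i)).
Qed.

End BoundedIntegrals.

Section UnitCube.
Local Open Scope classical_set_scope.
Variables (R : realType) (n : nat).
Local Notation mR := (measurableTypeR R).

Definition unit_cube : set (n.-tuple mR) := [set x | forall i, 0 <= tnth x i <= 1].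

Lemma unit_cubeE : unit_cube = box (fun=> `[0, 1]).
Proof. by apply/seteqP; split=> x x01 i; have := x01 i; rewrite /= in_itv. Qed.

Lemma measurable_unit_cube : measurable unit_cube.
Proof. by rewrite unit_cubeE; apply: measurable_box => i; exact: measurable_itv. Qed.

Lemma cube_prob_unit_cube : cube_prob R n unit_cube = 1%E.
Proof.
rewrite unit_cubeE cube_prob_box; last by move=> i; exact: measurable_itv.
by rewrite big1// => i _; rewrite /uniform_prob integral_uniform_pdf1.
Qed.

Lemma Rintegral_unit_cube_cst (c : R) : \int[cube_prob R n]_(x in unit_cube) c = c.
Proof.
rewrite Rintegral_cst; last exact: measurable_unit_cube.
rewrite -[RHS]mulr1; congr (_ * _).
by have /(congr1 fine) := cube_prob_unit_cube.
Qed.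

Lemma integral_unit_cube (f : n.-tuple mR -> R) :
  measurable_fun [set: n.-tuple mR] f -> (forall x, 0 <= f x) ->
  (\int[cube_prob R n]_(x in unit_cube) (f x)%:E = \int[cube_prob R n]_x (f x)%:E)%E.
Proof.
move=> mf f_ge0; have mC := measurable_unit_cube.
rewrite [RHS](@ge0_negligible_integral _ _ _ _ _ (~` unit_cube))//.
- by rewrite setTD setCK.
- exact: measurableC.
- exact/measurable_EFinP.
- by move=> x _; rewrite lee_fin.
- have := probability_setC (cube_prob R n) mC.
  by rewrite cube_prob_unit_cube subee.
Qed.

End UnitCube.

Section Sampling.
Local Open Scope classical_set_scope.
Variable R : realType.
Local Notation mR := (measurableTypeR R).
Variable W : mR * mR -> R.
Hypothesis W_graphon : graphon W.

(* Extended by zero, W is measurable on the whole plane. *)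
Definition graphon_ext : mR * mR -> R := W \_ (@unit_square R).

Lemma graphon_extE z : unit_square z -> graphon_ext z = W z.
Proof. by move=> z_sq; rewrite /graphon_ext patchE mem_set. Qed.

Lemma graphon_ext01 z : 0 <= graphon_ext z <= 1.
Proof.
have [_ _ W01] := W_graphon; rewrite /graphon_ext patchE.
by case: ifPn => [/set_mem/W01//|_]; rewrite lexx ler01.
Qed.

Lemma graphon_ext_sym a b : graphon_ext (a, b) = graphon_ext (b, a).
Proof.
have [_ W_sym _] := W_graphon; rewrite /graphon_ext !patchE.
have -> : ((b, a) \in @unit_square R) = ((a, b) \in @unit_square R).
  by apply/idP/idP => /set_mem[/= ? ?]; apply: mem_set.
by case: ifPn => // /set_mem; exact: W_sym.
Qed.

Lemma measurable_graphon_ext : measurable_fun setT graphon_ext.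
Proof.
have [mW _ _] := W_graphon.
have mS : measurable (@unit_square R) by apply: measurableX; exact: measurable_itv.
exact/(measurable_restrictT W mS).
Qed.

Definition sample_weight n (x : n.-tuple mR) (i j : 'I_n) : R :=
  graphon_ext (tnth x i, tnth x j).

Lemma sample_weight_sym_weight n (x : n.-tuple mR) : sym_weight (sample_weight x).
Proof.
split=> i j; first exact: graphon_ext_sym.
by have /andP[] := graphon_ext01 (tnth x i, tnth x j).
Qed.

Lemma sample_weightE n (x : n.-tuple mR) i j :
  unit_cube x -> sample_weight x i j = W (tnth x i, tnth x j).
Proof. by move=> x01; apply: graphon_extE; split; rewrite /= in_itv; exact: x01. Qed.

Variable G : sgraph.

Definition sample_mean n (phi : G -> 'I_n) : R :=
  \int[cube_prob R n]_(x in @unit_cube R n) edge_prod (sample_weight x) phi.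

Lemma edge_prod_sample01 n (phi : G -> 'I_n) (x : n.-tuple mR) :
  0 <= edge_prod (sample_weight x) phi <= 1.
Proof.
have [_ w_ge0] := sample_weight_sym_weight x; rewrite edge_prod_ge0//=.
apply: edge_prod_le1 => // i j.
by have /andP[] := graphon_ext01 (tnth x i, tnth x j).
Qed.

Lemma measurable_edge_prod n (phi : G -> 'I_n) :
  measurable_fun [set: n.-tuple mR] (fun x => edge_prod (sample_weight x) phi).
Proof.
rewrite /edge_prod; under eq_fun do rewrite -big_filter.
apply: measurable_prod => e _; rewrite /edge_weight.
case: pickP => [p _|_]; last exact: measurable_cst.
apply: (@measurableT_comp _ _ _ _ _ _ graphon_ext).
  exact: measurable_graphon_ext.
by apply: measurable_fun_pair; exact: measurable_tnth.
Qed.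

Lemma integrable_edge_prod n (phi : G -> 'I_n) :
  (cube_prob R n).-integrable (@unit_cube R n)
    (EFin \o (fun x => edge_prod (sample_weight x) phi)).
Proof.
apply: integrable_unit_valued; first exact: measurable_unit_cube.
  by apply: measurable_funTS; exact: measurable_edge_prod.
exact: edge_prod_sample01.
Qed.

Lemma integrable_dens n :
  (cube_prob R n).-integrable (@unit_cube R n)
    (EFin \o (fun x => dens (sample_weight x) G)).
Proof.
pose f (phi : {ffun G -> 'I_n}) x := edge_prod (sample_weight x) phi.
have int_f phi : (cube_prob R n).-integrable (@unit_cube R n) (EFin \o f phi).
  exact: integrable_edge_prod.
exact: (integrable_mean (@measurable_unit_cube R n) int_f).
Qed.

Lemma sample_mean_le1 n (phi : G -> 'I_n) : sample_mean phi <= 1.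
Proof.
have mC := @measurable_unit_cube R n.
rewrite -[X in _ <= X](Rintegral_unit_cube_cst n).
apply: le_Rintegral => //; first exact: integrable_edge_prod.
  by apply: integrable_unit_valued => // x; rewrite ler01 lexx.
by move=> x _; case/andP: (edge_prod_sample01 phi x).
Qed.

Lemma sample_mean_inj n (phi : G -> 'I_n) : injective phi ->
  sample_mean phi = hom_density G W.
Proof.
move=> phi_inj; transitivity (sample_mean (@enum_rank G)); last first.
  apply: eq_Rintegral => y /set_mem y01.
  rewrite -edge_prod_oriented; last by case: (sample_weight_sym_weight y).
  by apply: eq_bigr => p _; exact: sample_weightE.
pose h (j : 'I_#|G|) := phi (enum_val j).
have h_inj : injective h by move=> j j' /phi_inj/enum_val_inj.
have ge0 k (psi : G -> 'I_k) x : 0 <= edge_prod (sample_weight x) psi.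
  by case/andP: (edge_prod_sample01 psi x).
rewrite /sample_mean /Rintegral !integral_unit_cube//; try exact: measurable_edge_prod.
congr fine; rewrite -(integral_tuple_sel h_inj)//; last exact: measurable_edge_prod.
apply: eq_integral => x _; congr (_%:E); apply: eq_bigr => e _.
rewrite /edge_weight; case: pickP => // p _.
by rewrite /sample_weight !tnth_mktuple /h !enum_rankK.
Qed.

Lemma hom_density_ge0 : 0 <= hom_density G W.
Proof.
rewrite -(sample_mean_inj (@enum_rank_inj G)); apply: Rintegral_ge0 => x _.
by case/andP: (edge_prod_sample01 (@enum_rank G) x).
Qed.

(* Only the non-injective maps contribute to the error. *)
Lemma Rintegral_dens_sample_le n :
  \int[cube_prob R n.+1]_(x in @unit_cube R n.+1) dens (sample_weight x) G <=
  hom_density G W + (#|G| ^ 2)%:R / n.+1%:R.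
Proof.
have V_gt0 : (0 < #|'I_n.+1|)%N by rewrite card_ord.
pose f (phi : {ffun G -> 'I_n.+1}) x := edge_prod (sample_weight x) phi.
have int_f phi : (cube_prob R n.+1).-integrable (@unit_cube R n.+1) (EFin \o f phi).
  exact: integrable_edge_prod.
rewrite [leLHS](Rintegral_mean (@measurable_unit_cube R n.+1) int_f).
have := mean_not_injective_le R G V_gt0; rewrite card_ord.
rewrite -(lerD2l (hom_density G W)); apply: le_trans.
rewrite -{1}(mean_cst (hom_density G W) (card_ffun_gt0 V_gt0 G)) -meanD.
apply: ler_mean => phi; have [/injectiveP phi_inj|_] := boolP (injectiveb phi).
  by rewrite addr0 -(sample_mean_inj phi_inj).
by apply: le_trans (sample_mean_le1 phi) _; rewrite lerDr hom_density_ge0.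
Qed.

End Sampling.

Lemma ler_natdiv (R : archiRealFieldType) (a b c : R) :
  (forall n : nat, a <= b + c / n.+1%:R) -> a <= b.
Proof.
move=> le_ab; apply/ler_addgt0Pr => eps eps_gt0.
have := archi_boundP (divr_ge0 (normr_ge0 c) (ltW eps_gt0)).
set n := Num.bound _ => lt_n; apply: le_trans (le_ab n) _; rewrite lerD2l.
rewrite ler_pdivrMr ?ltr0n// mulrC; apply: le_trans (ler_norm c) _.
rewrite -ler_pdivrMr// (le_trans (ltW lt_n))// ler_nat.
exact: leqnSn.
Qed.

Section Transfer.
Local Open Scope classical_set_scope.
Variables (R : realType) (H1 H2 : sgraph) (a b1 b2 : R).
Hypotheses (b1_ge0 : 0 <= b1) (b2_ge0 : 0 <= b2).

Lemma hom_density_transfer (W1 W2 : measurableTypeR R * measurableTypeR R -> R) :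
  (forall n (w1 w2 : 'I_n.+1 -> 'I_n.+1 -> R),
     sym_weight w1 -> sym_weight w2 -> (forall x y, w1 x y + w2 x y = 1) ->
     a <= dens w1 H1 / b1 + dens w2 H2 / b2) ->
  graphon W1 -> graphon W2 -> (forall z, unit_square z -> W1 z + W2 z = 1) ->
  a <= hom_density H1 W1 / b1 + hom_density H2 W2 / b2.
Proof.
move=> finite_le gW1 gW2 W12.
apply: (@ler_natdiv _ _ _ ((#|H1| ^ 2)%:R / b1 + (#|H2| ^ 2)%:R / b2)) => n.
have mC := @measurable_unit_cube R n.+1.
have int1 := integrable_dens gW1 H1 n.+1; have int2 := integrable_dens gW2 H2 n.+1.
have int1b := integrableZr mC b1^-1 int1; have int2b := integrableZr mC b2^-1 int2.
have expect_le : a <= \int[cube_prob R n.+1]_(x in @unit_cube R n.+1)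
    (dens (sample_weight W1 x) H1 / b1 + dens (sample_weight W2 x) H2 / b2).
  rewrite -[X in X <= _](Rintegral_unit_cube_cst n.+1); apply: le_Rintegral => //.
  - exact: finite_measure_integrable_cst.
  - exact: (integrableD mC int1b int2b).
  move=> x x01; apply: finite_le => [||i j]; try exact: sample_weight_sym_weight.
  by rewrite !sample_weightE// W12//; split; rewrite /= in_itv; exact: x01.
apply: le_trans expect_le _; rewrite RintegralD//.
rewrite (RintegralZr _ mC int1) (RintegralZr _ mC int2) mulrDl addrACA.
rewrite ![_ / _ / n.+1%:R]mulrAC -!mulrDl.
by apply: lerD; rewrite ler_wpM2r ?invr_ge0//; apply: Rintegral_dens_sample_le.
Qed.

End Transfer.

Theorem theorem6p1 (R : realType) (m : nat) (m_ge3 : (3 <= m)%N) (m_odd : odd m)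
  (P1 P2 : template (cycle_graph m))
  (good1 : good R P1) (good2 : good R P2)
  (l1 l2 : nat) (H1 H2 : sgraph)
  (H1_del : obtained_by_deletion (glued P1) l1 H1)
  (H2_del : obtained_by_deletion (glued P2) l2 H2)
  (H1_edges : (m <= nedges H1)%N) (H2_edges : (m <= nedges H2)%N)
  (p1 p2 : R) (p1_01 : 0 < p1 < 1) (p2_01 : 0 < p2 < 1) (p12 : p1 + p2 = 1)
  (balance :
    (nedges H1 + l1)%:R / ((nedges H1)%:R * p1 ^+ m.-1) =
    (nedges H2 + l2)%:R / ((nedges H2)%:R * p2 ^+ m.-1)) :
  common p1 p2 H1 H2.
Proof.
have m_gt0 : (0 < m)%N by apply: leq_trans m_ge3.
have /andP[p1_gt0 _] := p1_01; have /andP[p2_gt0 _] := p2_01.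
split; [exact: leq_trans H1_edges|exact: leq_trans H2_edges|move=> W1 W2].
apply: hom_density_transfer => [||n w1 w2 w1_weight w2_weight w12].
- by rewrite mulr_ge0// exprn_ge0// ltW.
- by rewrite mulr_ge0// exprn_ge0// ltW.
exact: (finite_common m_ge3 m_odd w1_weight w2_weight w12 good1 good2 H1_del H2_del).
Qed.
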